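(* Let $R$ be a commutative Noetherian ring with non-zero identity, $\mathfrak a$ an ideal of $R$, $M$ a finitely generated $R$-module, $X$ an arbitrary $R$-module and $n$ a non-negative integer. Let $$P_n=\bigcup_{i<n}\operatorname{Supp}_R(H^i_{\mathfrak a}(M,X))\quad\Big(=\bigcup_{i<n}\operatorname{Supp}_R(\operatorname{Ext}^i_R(M/\mathfrak aM,X))\Big).$$ Then: (a) $\operatorname{Ass}_R(H^n_{\mathfrak a}(M,X))\cup P_n=\operatorname{Ass}_R(\operatorname{Ext}^n_R(M/\mathfrak aM,X))\cup P_n$. (b) $\operatorname{Ass}_R(H^n_{\mathfrak a}(M,X))\subseteq\operatorname{Ass}_R(\operatorname{Ext}^n_R(M/\mathfrak aM,X))\cup P_n$. (c) $\operatorname{Ass}_R(\operatorname{Ext}^n_R(M/\mathfrak aM,X))\subseteq\operatorname{Ass}_R(H^n_{\mathfrak a}(M,X))\cup P_n$. (d) If $H^i_{\mathfrak a}(M,X)$ has finite support for all $i<n$, then $\operatorname{Ass}_R(H^n_{\mathfrak a}(M,X))$ is a finite set if and only if $\operatorname{Ass}_R(\operatorname{Ext}^n_R(M/\mathfrak aM,X))$ is a finite set.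
   Context: $H^i_{\mathfrak a}(M,X)=\varinjlim_{k}\operatorname{Ext}^i_R(M/\mathfrak a^kM,X)$ is the $i$-th generalized local cohomology module. *)

(* Defs.v *)
From HB Require Import structures.
From mathcomp Require Import all_boot all_order all_algebra generic_quotient.
From mathcomp Require Import boolp classical_sets functions cardinality.

Set Implicit Arguments.
Unset Strict Implicit.
Unset Printing Implicit Defensive.
Import GRing.Theory Num.Theory.
Local Open Scope classical_set_scope.
Local Open Scope ring_scope.
Local Open Scope quotient_scope.

Section Submodules.
Variable R : pzRingType.

Definition is_submodule (V : lmodType R) (S : set V) : Prop :=
  [/\ S 0, forall x y, S x -> S y -> S (x + y) & forall r x, S x -> S (r *: x)].

Record submodule (V : lmodType R) := Submodule {
  carrier :> set V;
  carrierP : is_submodule carrier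
}.

Section Constructions.
Variables V W : lmodType R.

Lemma full_is_submodule : is_submodule [set: V].
Proof. by []. Qed.
Definition full : submodule V := Submodule full_is_submodule.

Lemma zero_is_submodule : is_submodule [set 0 : V].
Proof.
split=> //= [x y -> ->|r x ->]; first by rewrite addr0.
by rewrite scaler0.
Qed.
Definition zero_submodule : submodule V := Submodule zero_is_submodule.

Lemma smallest_is_submodule (A : set V) :
  is_submodule (smallest (@is_submodule V) A).
Proof.
split=> [S [[S0 _ _] _]|x y xA yA S SP|r x xA S SP] //.
  by have [[_ SD _] _] := SP; apply: SD; [exact: xA|exact: yA].
by have [[_ _ SZ] _] := SP; apply: SZ; exact: xA.
Qed.
Definition generated (A : set V) : submodule V :=
  Submodule (smallest_is_submodule A).

Lemma ker_is_submodule (f : {linear V -> W}) : is_submodule [set x | f x = 0].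
Proof.
split=> [|x y /= fx fy|r x /= fx] /=; first exact: linear0.
  by rewrite linearD fx fy addr0.
by rewrite linearZ fx /= scaler0.
Qed.
Definition ker f : submodule V := Submodule (ker_is_submodule f).

Lemma im_is_submodule (f : {linear V -> W}) : is_submodule (range f).
Proof.
split=> [|_ _ [x _ <-] [y _ <-]|r _ [x _ <-]].
- by exists 0 => //; exact: linear0.
- by exists (x + y) => //; exact: linearD.
- by exists (r *: x) => //; rewrite linearZ.
Qed.
Definition im f : submodule W := Submodule (im_is_submodule f).

End Constructions.

Section SubmoduleModule.
Variables (V : lmodType R) (S : submodule V).

Definition mem_submodule : {pred V} := fun x => x \in (S : set V).

Lemma mem_submodule_closed : GRing.submod_closed mem_submodule.
Proof.
have [S0 SD SZ] := carrierP S.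
split=> [|r x y]; rewrite /mem_submodule !unfold_in !inE //=.
by move=> Sx Sy; apply: SD => //; exact: SZ.
Qed.
HB.instance Definition _ :=
  GRing.isSubmodClosed.Build R V mem_submodule mem_submodule_closed.

Definition sub_module : Type := {x : V | x \in mem_submodule}.
HB.instance Definition _ := SubChoice.on sub_module.
HB.instance Definition _ := [SubChoice_isSubLmodule of sub_module by <:].

Definition quot_module : Type := Quotient.quot mem_submodule.
HB.instance Definition _ := EqQuotient.on quot_module.
HB.instance Definition _ := GRing.Zmodule.on quot_module.

Definition quot_proj (x : V) : quot_module := \pi_quot_module x.

Lemma quot_projP (x y : V) : quot_proj x = quot_proj y <-> carrier S (x - y).
Proof.
have E : (quot_proj x == quot_proj y) = (x - y \in carrier S).
  exact/esym/(@Quotient.idealrBE _ mem_submodule).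
by split=> [/eqP|xy]; [rewrite E inE|apply/eqP; rewrite E inE].
Qed.

Lemma quot_projK (u : quot_module) : quot_proj (repr u) = u.
Proof. exact: reprK. Qed.

Lemma quot_projB : {morph quot_proj : x y / x - y}.
Proof. exact: (raddfB \pi_quot_module). Qed.

Lemma quot_projD : {morph quot_proj : x y / x + y}.
Proof. exact: (raddfD \pi_quot_module). Qed.

Definition quot_scale (r : R) (u : quot_module) : quot_module :=
  quot_proj (r *: repr u).

Lemma quot_projZ r x : quot_scale r (quot_proj x) = quot_proj (r *: x).
Proof.
apply/quot_projP; rewrite -scalerBr.
by have [_ _ SZ] := carrierP S; apply/SZ/quot_projP; rewrite quot_projK.
Qed.

Lemma quot_scaleA r s u :
  quot_scale r (quot_scale s u) = quot_scale (r * s) u.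
Proof. by rewrite -(quot_projK u) !quot_projZ scalerA. Qed.
Lemma quot_scale1 : left_id 1 quot_scale.
Proof. by move=> u; rewrite -(quot_projK u) quot_projZ scale1r. Qed.
Lemma quot_scaleDr : right_distributive quot_scale +%R.
Proof.
move=> r u v; rewrite -(quot_projK u) -(quot_projK v).
by rewrite -quot_projD !quot_projZ scalerDr quot_projD.
Qed.
Lemma quot_scaleDl u : {morph quot_scale^~ u : r s / r + s}.
Proof. by move=> r s; rewrite -(quot_projK u) !quot_projZ scalerDl quot_projD. Qed.
HB.instance Definition _ := GRing.Zmodule_isLmodule.Build R quot_module
  quot_scaleA quot_scale1 quot_scaleDr quot_scaleDl.

Lemma quot_proj_is_linear : linear quot_proj.
Proof. by move=> r x y; rewrite quot_projD -quot_projZ. Qed.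
HB.instance Definition _ :=
  GRing.isLinear.Build R V quot_module _ quot_proj quot_proj_is_linear.

End SubmoduleModule.

Section InducedMaps.
Variables (V W : lmodType R) (S : submodule V) (T : submodule W).
Variable f : {linear V -> W}.
Let maps_to := forall x, carrier S x -> carrier T (f x).

Lemma sub_map_subproof (fST : maps_to) (x : sub_module S) :
  f (val x) \in mem_submodule T.
Proof.
by rewrite unfold_in /mem_submodule inE; apply: fST; have := valP x; rewrite inE.
Qed.
Definition sub_map (fST : maps_to) (x : sub_module S) : sub_module T :=
  Sub (f (val x)) (sub_map_subproof fST x).
Lemma sub_map_is_linear fST : linear (sub_map fST).
Proof. by move=> r x y; apply: val_inj; rewrite /= !linearP. Qed.
HB.instance Definition _ fST :=
  GRing.isLinear.Build R _ _ _ (sub_map fST) (sub_map_is_linear fST).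

Definition quot_map (fST : maps_to) (u : quot_module S) : quot_module T :=
  quot_proj T (f (repr u)).
Lemma quot_mapE fST x : quot_map fST (quot_proj S x) = quot_proj T (f x).
Proof.
by apply/quot_projP; rewrite -linearB; apply/fST/quot_projP; rewrite quot_projK.
Qed.
Lemma quot_map_is_linear fST : linear (quot_map fST).
Proof.
move=> r u v; rewrite -(quot_projK u) -(quot_projK v).
by rewrite -linearP !quot_mapE !linearP.
Qed.
HB.instance Definition _ fST :=
  GRing.isLinear.Build R _ _ _ (quot_map fST) (quot_map_is_linear fST).

End InducedMaps.

Section Restrict.
Variables (V : lmodType R) (S T : submodule V).
Lemma restrict_is_submodule :
  is_submodule [set x : sub_module S | carrier T (val x)].
Proof.
have [T0 TD TZ] := carrierP T.
by split=> [|x y|r x] /=; [exact: T0|exact: TD|exact: TZ].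
Qed.
Definition restrict : submodule (sub_module S) :=
  Submodule restrict_is_submodule.
End Restrict.

End Submodules.

Section DependentProduct.
Variables (R : pzRingType) (I : Type) (E : I -> lmodType R).

Definition dprod : Type := forall i, E i.
Implicit Types x y z : dprod.

HB.instance Definition _ := gen_eqMixin dprod.
HB.instance Definition _ := gen_choiceMixin dprod.

Definition dprod_zero : dprod := fun=> 0.
Definition dprod_opp x : dprod := fun i => - x i.
Definition dprod_add x y : dprod := fun i => x i + y i.
Definition dprod_scale (r : R) x : dprod := fun i => r *: x i.

Lemma dprod_addA : associative dprod_add.
Proof. by move=> x y z; apply/functional_extensionality_dep => i; exact: addrA. Qed.
Lemma dprod_addC : commutative dprod_add.
Proof. by move=> x y; apply/functional_extensionality_dep => i; exact: addrC. Qed.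
Lemma dprod_add0 : left_id dprod_zero dprod_add.
Proof. by move=> x; apply/functional_extensionality_dep => i; exact: add0r. Qed.
Lemma dprod_addN : left_inverse dprod_zero dprod_opp dprod_add.
Proof. by move=> x; apply/functional_extensionality_dep => i; exact: addNr. Qed.
HB.instance Definition _ :=
  GRing.isZmodule.Build dprod dprod_addA dprod_addC dprod_add0 dprod_addN.

Lemma dprod_scaleA r s x :
  dprod_scale r (dprod_scale s x) = dprod_scale (r * s) x.
Proof. by apply/functional_extensionality_dep => i; exact: scalerA. Qed.
Lemma dprod_scale1 : left_id 1 dprod_scale.
Proof. by move=> x; apply/functional_extensionality_dep => i; exact: scale1r. Qed.
Lemma dprod_scaleDr : right_distributive dprod_scale +%R.
Proof. by move=> r x y; apply/functional_extensionality_dep => i; exact: scalerDr. Qed.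
Lemma dprod_scaleDl x : {morph dprod_scale^~ x : r s / r + s}.
Proof. by move=> r s; apply/functional_extensionality_dep => i; exact: scalerDl. Qed.
HB.instance Definition _ := GRing.Zmodule_isLmodule.Build R dprod
  dprod_scaleA dprod_scale1 dprod_scaleDr dprod_scaleDl.

End DependentProduct.

(* The direct limit of E 0 -> E 1 -> E 2 -> ... is the quotient of the direct
   sum of the E k by the elements in_k x - in_(k+1) (t k x), which span the
   image of x |-> x - shift x on finitely supported sequences. *)
Section DirectLimit.
Variables (R : pzRingType) (E : nat -> lmodType R).
Variable t : forall k, {linear E k -> E k.+1}.

Lemma dsum_is_submodule :
  is_submodule [set x : dprod E | exists m, forall k, (m <= k)%N -> x k = 0].
Proof.
split=> [|x y [m xm] [m' ym]|r x [m xm]] /=; first by exists 0%N.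
- exists (maxn m m') => k; rewrite geq_max => /andP[mk m'k].
  by rewrite /= /GRing.add /= /dprod_add xm // ym // addr0.
- by exists m => k mk; rewrite /GRing.scale /= /dprod_scale xm // scaler0.
Qed.
Definition dsum : submodule (dprod E) := Submodule dsum_is_submodule.

Definition shift (x : dprod E) : dprod E :=
  fun k => if k is j.+1 then t j (x j) else 0.

Lemma shift_is_linear : linear shift.
Proof.
move=> r x y; apply/functional_extensionality_dep => -[|k] /=.
  by rewrite [RHS]addr0 [RHS]scaler0.
exact: linearP.
Qed.
HB.instance Definition _ :=
  GRing.isLinear.Build R (dprod E) (dprod E) _ shift shift_is_linear.

Lemma telescope_is_submodule :
  is_submodule [set x - shift x | x in carrier dsum].
Proof.
have [D0 DD DZ] := carrierP dsum.
split=> [|_ _ [x Dx <-] [y Dy <-]|r _ [x Dx <-]].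
- by exists 0 => //; rewrite linear0 subr0.
- by exists (x + y); [exact: DD|rewrite linearD opprD addrACA].
- by exists (r *: x); [exact: DZ|rewrite linearZ scalerBr].
Qed.
Definition telescope : submodule (dprod E) := Submodule telescope_is_submodule.

Definition direct_limit : lmodType R := quot_module (restrict dsum telescope).

End DirectLimit.

Section Hom.
Variables (R : comNzRingType).

Section HomModule.
Variables (U V : lmodType R).
Implicit Types f g h : {linear U -> V}.

Lemma linear_funext f g : f =1 g -> f = g.
Proof.
case: f g => [f cf] [g cg] /= /funext fg; move: cf cg; rewrite -{g}fg => cf cg.
congr (GRing.Linear.Pack _).
case: cf cg => [[p] [q]] [[p'] [q']].
by rewrite (Prop_irrelevance p p') (Prop_irrelevance q q').
Qed.

HB.instance Definition _ := gen_eqMixin {linear U -> V}.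
HB.instance Definition _ := gen_choiceMixin {linear U -> V}.

Definition hom_zero : {linear U -> V} := \0.
Definition hom_opp f : {linear U -> V} := \- f.
Definition hom_add f g : {linear U -> V} := f \+ g.
Definition hom_scale (r : R) f : {linear U -> V} := r \*: f.

Lemma hom_addA : associative hom_add.
Proof. by move=> f g h; apply/linear_funext => x; exact: addrA. Qed.
Lemma hom_addC : commutative hom_add.
Proof. by move=> f g; apply/linear_funext => x; exact: addrC. Qed.
Lemma hom_add0 : left_id hom_zero hom_add.
Proof. by move=> f; apply/linear_funext => x; exact: add0r. Qed.
Lemma hom_addN : left_inverse hom_zero hom_opp hom_add.
Proof. by move=> f; apply/linear_funext => x; exact: addNr. Qed.
HB.instance Definition _ := GRing.isZmodule.Build {linear U -> V}
  hom_addA hom_addC hom_add0 hom_addN.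

Lemma hom_scaleA r s f : hom_scale r (hom_scale s f) = hom_scale (r * s) f.
Proof. by apply/linear_funext => x; exact: scalerA. Qed.
Lemma hom_scale1 : left_id 1 hom_scale.
Proof. by move=> f; apply/linear_funext => x; exact: scale1r. Qed.
Lemma hom_scaleDr : right_distributive hom_scale +%R.
Proof. by move=> r f g; apply/linear_funext => x; exact: scalerDr. Qed.
Lemma hom_scaleDl f : {morph hom_scale^~ f : r s / r + s}.
Proof. by move=> r s; apply/linear_funext => x; exact: scalerDl. Qed.
HB.instance Definition _ := GRing.Zmodule_isLmodule.Build R {linear U -> V}
  hom_scaleA hom_scale1 hom_scaleDr hom_scaleDl.

End HomModule.

Variables (U V W : lmodType R).

Definition postcomp (g : {linear V -> W}) (f : {linear U -> V}) :
  {linear U -> W} := g \o f.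
Lemma postcomp_is_linear g : linear (postcomp g).
Proof. by move=> r f f'; apply/linear_funext => x; exact: linearP. Qed.
HB.instance Definition _ g :=
  GRing.isLinear.Build R _ _ _ (postcomp g) (postcomp_is_linear g).

Definition precomp (f : {linear U -> V}) (g : {linear V -> W}) :
  {linear U -> W} := g \o f.
Lemma precomp_is_linear f : linear (precomp f).
Proof. by move=> r g g'; apply/linear_funext. Qed.
HB.instance Definition _ f :=
  GRing.isLinear.Build R _ _ _ (precomp f) (precomp_is_linear f).

End Hom.

Section InjectiveResolutions.
Variable R : comNzRingType.

Definition injective_module (D : lmodType R) : Prop :=
  forall (A B : lmodType R) (i : {linear A -> B}) (f : {linear A -> D}),
    injective i -> exists g : {linear B -> D}, forall x, g (i x) = f x.

(* 0 -> X -> J 0 -> J 1 -> ... exact, with every J n injective *)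
Record injective_resolution (X : lmodType R) := InjectiveResolution {
  res_obj :> nat -> lmodType R;
  res_aug : {linear X -> res_obj 0%N};
  res_diff : forall n, {linear res_obj n -> res_obj n.+1};
  res_obj_injective : forall n, injective_module (res_obj n);
  res_aug_inj : injective res_aug;
  res_exact0 : carrier (ker (res_diff 0)) = carrier (im res_aug);
  res_exactS : forall n,
    carrier (ker (res_diff n.+1)) = carrier (im (res_diff n))
}.

End InjectiveResolutions.

(* Ext^n_R(N, X) is the n-th cohomology of the complex Hom_R(N, J), for J an
   injective resolution of X; standard_resolution below shows that one exists
   for every X. *)
Section Ext.
Variables (R : comNzRingType) (X : lmodType R) (J : injective_resolution X).

Definition cocycles (N : lmodType R) (n : nat) :
    submodule {linear N -> J n} :=
  ker (postcomp (res_diff J n)).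

Definition coboundaries (N : lmodType R) (n : nat) :
    submodule {linear N -> J n} :=
  match n with
  | 0 => zero_submodule _
  | m.+1 => im (postcomp (res_diff J m))
  end.

Definition Ext (n : nat) (N : lmodType R) : lmodType R :=
  quot_module (restrict (cocycles N n) (coboundaries N n)).

Section Functoriality.
Variables (N N' : lmodType R) (phi : {linear N -> N'}) (n : nat).

Lemma precomp_cocycles g :
  carrier (cocycles N' n) g -> carrier (cocycles N n) (precomp phi g).
Proof.
move=> /= dg; apply/linear_funext => x.
by have /(congr1 (fun h : {linear _ -> _} => h (phi x))) := dg.
Qed.

Lemma precomp_coboundaries g :
  carrier (coboundaries N' n) g -> carrier (coboundaries N n) (precomp phi g).
Proof.
case: n g => [g /= ->|m g [h _ <-]]; first exact/linear_funext.
by exists (precomp phi h) => //; exact/linear_funext.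
Qed.

Definition Ext_map : {linear Ext n N' -> Ext n N} :=
  quot_map (S := restrict (cocycles N' n) (coboundaries N' n))
    (T := restrict (cocycles N n) (coboundaries N n))
    (f := sub_map precomp_cocycles) (fun u => @precomp_coboundaries (val u)).

End Functoriality.
End Ext.

Section LocalCohomology.
Variable R : comNzRingType.

Definition ideal := submodule R^o.

Section IdealPowers.
Variable a : ideal.

Definition ideal_smul (V : lmodType R) (S : submodule V) : submodule V :=
  generated [set r *: x | r in carrier a & x in carrier S].

Fixpoint ideal_pow (k : nat) : ideal :=
  if k is j.+1 then ideal_smul (ideal_pow j) else full R^o.

End IdealPowers.

Definition quot_ideal (a : ideal) (M : lmodType R) : lmodType R :=
  quot_module (ideal_smul a (full M)).

Variables (a : ideal) (M : lmodType R).

Lemma ideal_powS_sub k : carrier (ideal_pow a k.+1) `<=` carrier (ideal_pow a k).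
Proof.
apply: smallest_sub; first exact: carrierP.
by move=> _ [r ar [x ax <-]]; have [_ _ SZ] := carrierP (ideal_pow a k); exact: SZ.
Qed.

Lemma ideal_pow_smul_sub k (x : M) :
  carrier (ideal_smul (ideal_pow a k.+1) (full M)) x ->
  carrier (ideal_smul (ideal_pow a k) (full M)) (idfun x).
Proof.
move: x; apply: smallest_sub; first exact: carrierP.
move=> _ [r ar [x _ <-]]; apply: sub_gen_smallest.
by exists r; [exact: ideal_powS_sub|exists x].
Qed.

Definition quot_pow_proj (k : nat) :
    {linear quot_ideal (ideal_pow a k.+1) M -> quot_ideal (ideal_pow a k) M} :=
  quot_map (@ideal_pow_smul_sub k).

Variables (X : lmodType R) (J : injective_resolution X).

(* H^n_a(M, X) = colim_k Ext^n(M / a^k M, X) *)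
Definition local_cohomology (n : nat) : lmodType R :=
  @direct_limit R (fun k => Ext J n (quot_ideal (ideal_pow a k) M))
    (fun k => Ext_map J (quot_pow_proj k) n).

End LocalCohomology.

Section AssociatedPrimes.
Variable R : comNzRingType.

Definition finitely_generated_submodule (V : lmodType R) (S : submodule V) :=
  exists2 A : set V, finite_set A & carrier S = carrier (generated A).

Definition finitely_generated (V : lmodType R) :=
  finitely_generated_submodule (full V).

Definition noetherian_ring : Prop :=
  forall I : ideal R, finitely_generated_submodule I.

Definition prime_ideal (p : set R) : Prop :=
  [/\ is_submodule (p : set R^o), ~ p 1 &
      forall x y, p (x * y) -> p x \/ p y].

Definition annihilator (V : lmodType R) (x : V) : set R := [set r | r *: x = 0].

Definition Ass (V : lmodType R) : set (set R) :=
  [set p | prime_ideal p /\ exists x : V, p = annihilator x].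

(* x / s = y / t in the localization V_p *)
Definition frac_eq (V : lmodType R) (p : set R) (x : V) (s : R) (y : V) (t : R) :=
  exists2 u : R, ~ p u & u *: (t *: x - s *: y) = 0.

(* V_p <> 0: some fraction x / s of V_p differs from 0 / 1 *)
Definition Supp (V : lmodType R) : set (set R) :=
  [set p | prime_ideal p /\
     exists (x : V) (s : R), ~ p s /\ ~ frac_eq p x s 0 1].

End AssociatedPrimes.

(* Every module has an injective resolution: X embeds in the module
   coinduced X = Hom_Z(R, Q/Z)^(X^* ), X^* = Hom_Z(X, Q/Z), which is injective
   because Q/Z is divisible. *)

Section DivisibleExtension.
Variables (B D : zmodType).
Hypothesis divD : forall (n : nat) (d : D), (0 < n)%N -> exists y, y *+ n = d.

Definition partial_morphism (G : set (B * D)) : Prop :=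
  [/\ G (0, 0),
      forall x d y e, G (x, d) -> G (y, e) -> G (x - y, d - e) &
      forall d, G (0, d) -> d = 0].

Section Closure.
Variable G : set (B * D).
Hypothesis GP : partial_morphism G.

Lemma partial_morphismN x d : G (x, d) -> G (- x, - d).
Proof.
by have [G0 GB _] := GP; rewrite -[- x]add0r -[- d]add0r => /(GB _ _ _ _ G0).
Qed.

Lemma partial_morphismD x d y e :
  G (x, d) -> G (y, e) -> G (x + y, d + e).
Proof.
have [_ GB _] := GP; move=> Gx /partial_morphismN Gy.
by rewrite -[y]opprK -[e]opprK; exact: GB.
Qed.

Lemma partial_morphismMz x d k : G (x, d) -> G (x *~ k, d *~ k).
Proof.
move=> Gx; have Gn n : G (x *+ n, d *+ n).
  elim: n => [|n IH]; first by have [] := GP.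
  by rewrite !mulrS; exact: partial_morphismD.
by case: k => n; [exact: Gn|rewrite NegzE !mulrNz; exact/partial_morphismN/Gn].
Qed.

Lemma partial_morphism_fun x d e : G (x, d) -> G (x, e) -> d = e.
Proof.
have [_ GB Gf] := GP; move=> Gd Ge; apply/subr0_eq/Gf.
by rewrite -(subrr x); exact: GB.
Qed.

Lemma partial_morphism_value b :
  exists y, forall k e, G (b *~ k, e) -> e = y *~ k.
Proof.
have [_ GB Gf] := GP.
have [[n0 [n0_gt0 [d0 Gd0]]]|Hn] :=
    pselect (exists n : nat, (0 < n)%N /\ exists d, G (b *+ n, d)); last first.
  exists 0 => k e; rewrite mul0rz.
  case: k => [[|n]|n] Ge; first exact: Gf.
    by case: Hn; exists n.+1; split=> //; exists e.
  case: Hn; exists n.+1; split=> //; exists (- e).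
  by have := partial_morphismN Ge; rewrite NegzE mulrNz opprK.
have exn : exists n, (0 < n)%N && `[< exists d, G (b *+ n, d) >].
  by exists n0; rewrite n0_gt0; apply/asboolP; exists d0.
case: (ex_minnP exn) => n /andP[n_gt0 /asboolP[d Gd]] nmin.
have [y yn] := divD d n_gt0; exists y => k e Ge.
have Gqd : G (b *~ ((k %/ n)%Z * n), d *~ (k %/ n)%Z).
  by rewrite mulrC mulrzA; exact: partial_morphismMz.
have Gr : G (b *~ (k %% n)%Z, e - d *~ (k %/ n)%Z).
  have -> : (k %% n)%Z = k - (k %/ n)%Z * n.
    by rewrite [X in X - _](divz_eq k n) addrC addKr.
  by rewrite mulrzBr; exact: GB.
have [r kr] : exists r : nat, (k %% n)%Z = r.
  have := modz_ge0 k (lt0n_neq0 n_gt0 : n%:Z != 0).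
  by case: (k %% n)%Z => // r _; exists r.
have rn : (r < n)%N.
  have := ltz_pmod k (n_gt0 : (0 < n%:Z)%R).
  by rewrite kr.
have r0 : r = 0%N.
  apply/eqP; rewrite -leqn0 leqNgt; apply/negP => r_gt0.
  have := nmin r; rewrite r_gt0 /= leqNgt rn => /(_ _)/negP; apply => //.
  by apply/asboolP; exists (e - d *~ (k %/ n)%Z); rewrite kr in Gr.
move: Gr; rewrite kr r0 mulr0z => /Gf/subr0_eq ->.
by rewrite [in RHS](divz_eq k n) kr r0 addr0 mulrC mulrzA -yn.
Qed.

End Closure.

Lemma divisible_extension (G0 : set (B * D)) : partial_morphism G0 ->
  exists g : {additive B -> D}, forall x d, G0 (x, d) -> g x = d.
Proof.
move=> G0P.
pose P (G : set (B * D)) := G = set0 \/ (partial_morphism G /\ G0 `<=` G).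
have [F FP Ftot|A [AP Amax]] := @Zorn_bigcup _ P.
  have [[X [FX Xne]]|Hne] := pselect (exists X, F X /\ X <> set0); last first.
    left; apply/seteqP; split=> // z [X FX Xz].
    by case: Hne; exists X; split=> // X0; rewrite X0 in Xz.
  right; have FP' Y z : F Y -> Y z -> partial_morphism Y.
    by move=> FY Yz; case: (FP _ FY) => [Y0|[]//]; rewrite Y0 in Yz.
  have [/Xne []|[[X0 _ _] GX]] := FP _ FX.
  split; last by move=> z /GX Xz; exists X.
  split; first by exists X.
    move=> x d y e [Y FY Yx] [Z FZ Zy].
    have [YZ|ZY] := Ftot _ _ FY FZ.
      by exists Z => //; have [_ ZB _] := FP' _ _ FZ Zy; apply: ZB => //; exact: YZ.
    by exists Y => //; have [_ YB _] := FP' _ _ FY Yx; apply: YB => //; exact: ZY.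
  by move=> d [Y FY Yd]; have [_ _] := FP' _ _ FY Yd; exact.
have [Apm G0A] : partial_morphism A /\ G0 `<=` A.
  case: AP => // A0; have [G00 _ _] := G0P.
  have AG0 : A `<` G0 by rewrite A0; split=> // /(_ _ G00).
  by case: (Amax _ AG0); right; split.
have Atot b : exists d, A (b, d).
  apply: contrapT => bA; have [y yP] := partial_morphism_value Apm b.
  pose A' : set (B * D) :=
    [set z | exists x d k, A (x, d) /\ z = (x + b *~ k, d + y *~ k)].
  have [A00 AB Af] := Apm.
  have AA' : A `<=` A'.
    by move=> [x d] Ax; exists x, d, 0; rewrite !mulr0z !addr0.
  apply: (Amax A').
    split=> // A'A; apply: bA; exists y; apply: A'A.
    by exists 0, 0, 1; rewrite !add0r !mulr1z.
  right; split; last exact: subset_trans AA'.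
  split; first exact: AA'.
    move=> _ _ _ _ [x [d [k [Ax [-> ->]]]]] [x' [d' [k' [Ax' [-> ->]]]]].
    exists (x - x'), (d - d'), (k - k'); split; first exact: AB.
    by rewrite !mulrzBr !opprD !(addrACA _ (_ *~ k)).
  move=> _ [x [d [k [Ax [/eqP + ->]]]]].
  rewrite eq_sym addr_eq0 -mulrNz => /eqP xk.
  by rewrite xk in Ax; rewrite (yP _ _ Ax) mulrNz addNr.
have [g gP] := choice Atot.
have g_add : zmod_morphism g.
  move=> x y; apply: (partial_morphism_fun Apm) (gP _) _.
  by have [_ AB _] := Apm; exact: AB.
pose gm := GRing.isZmodMorphism.Build _ _ _ g_add.
pose ga : {additive B -> D} := HB.pack g gm.
by exists ga => x d /G0A; exact: partial_morphism_fun (gP x).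
Qed.

End DivisibleExtension.

Section RationalsModIntegers.

Definition int_rat : {pred rat} := fun x => x \is a Num.int.
Lemma int_rat_zmod_closed : zmod_closed int_rat.
Proof.
by split=> [|x y]; rewrite ?unfold_in /int_rat; [exact: rpred0|exact: rpredB].
Qed.
HB.instance Definition _ := GRing.isZmodClosed.Build rat int_rat int_rat_zmod_closed.

Definition rat_mod_int : zmodType := Quotient.quot int_rat.
Definition rat_proj (x : rat) : rat_mod_int := \pi_(Quotient.quot int_rat) x.

Lemma rat_projD : {morph rat_proj : x y / x + y}.
Proof. exact: (raddfD \pi_(Quotient.quot int_rat)). Qed.

Lemma rat_projMn x n : rat_proj (x *+ n) = rat_proj x *+ n.
Proof. exact: (raddfMn \pi_(Quotient.quot int_rat)). Qed.

Lemma rat_proj_eq0 x : (rat_proj x == 0) = (x \is a Num.int).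
Proof.
have <- : rat_proj 0 = 0 by exact: (raddf0 \pi_(Quotient.quot int_rat)).
have := @Quotient.idealrBE _ int_rat x 0; rewrite subr0 => E.
by apply/esym; exact: E.
Qed.

Lemma rat_mod_int_divisible (n : nat) (d : rat_mod_int) :
  (0 < n)%N -> exists y, y *+ n = d.
Proof.
move=> n_gt0; exists (rat_proj (repr d / n%:R)).
have n0 : n%:R != 0 :> rat by rewrite pnatr_eq0 -lt0n.
rewrite -rat_projMn -(mulr_natr (_ / _)) divfK //.
exact: (@reprK _ (Quotient.quot int_rat)).
Qed.

Lemma rat_mod_int_separates (B : zmodType) (b : B) :
  b != 0 -> exists g : {additive B -> rat_mod_int}, g b != 0.
Proof.
move=> b0.
have [y [y0 yP]] : exists y : rat_mod_int, y != 0 /\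
    forall n : nat, b *+ n = 0 -> y *+ n = 0.
  have half : rat_proj (1 / 2%:R) != 0 by rewrite rat_proj_eq0.
  have [[m [m_gt0 bm]]|Hm] := pselect (exists m : nat, (0 < m)%N /\ b *+ m = 0);
    last first.
    exists (rat_proj (1 / 2%:R)); split=> // -[//|n] bn.
    by case: Hm; exists n.+1.
  have exm : exists m, (0 < m)%N && (b *+ m == 0).
    by exists m; rewrite m_gt0 bm eqxx.
  case: (ex_minnP exm) => n /andP[n_gt0 /eqP bn] nmin.
  have n_gt1 : (1 < n)%N.
    by case: n n_gt0 bn {nmin} => [|[|]] // _; rewrite mulr1n => /eqP; rewrite (negPf b0).
  have n0 : n%:R != 0 :> rat by rewrite pnatr_eq0 -lt0n.
  exists (rat_proj n%:R^-1); split.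
    rewrite rat_proj_eq0; apply/negP => /intrP[z zn].
    have : (z * n%:Z)%:~R = 1 :> rat.
      by rewrite intrM -zn -pmulrn mulVf.
    move/eqP; rewrite -[1]/(1%:~R) eqr_int => /eqP/(congr1 absz).
    rewrite abszM /= => /eqP; rewrite muln_eq1 => /andP[_ /eqP n1].
    by rewrite n1 in n_gt1.
  move=> k bk; have /dvdnP[q ->] : (n %| k)%N.
    rewrite /dvdn -leqn0 leqNgt; apply/negP => r_gt0.
    have := nmin (k %% n)%N; rewrite r_gt0 /= leqNgt ltn_mod n_gt0 => H.
    suff /eqP/H : b *+ (k %% n) = 0 by [].
    move: bk; rewrite {1}(divn_eq k n) mulrnDr mulnC mulrnA bn mul0rn add0r.
    by [].
  rewrite -rat_projMn mulnC mulrnA -(mulr_natr _^-1) mulVf //.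
  by apply/eqP; rewrite rat_proj_eq0 rpred_nat.
have yPz (k : int) : b *~ k = 0 -> y *~ k = 0.
  case: k => k; first exact: yP.
  rewrite NegzE !mulrNz => /eqP; rewrite oppr_eq0 => /eqP/yP yk.
  by rewrite -[y *~ _]/(y *+ k.+1) yk oppr0.
pose G := [set (b *~ k, y *~ k) | k in [set: int]].
have [|g gP] := @divisible_extension B _ rat_mod_int_divisible G.
  split; first by exists 0.
    move=> _ _ _ _ [k _ [<- <-]] [l _ [<- <-]].
    by exists (k - l) => //; rewrite !mulrzBr.
  by move=> d [k _ [bk <-]]; exact: yPz.
by exists g; rewrite (gP b y) //; exists 1.
Qed.

End RationalsModIntegers.

Section EnoughInjectives.
Variable R : comNzRingType.
Local Notation D := rat_mod_int.

Section CharacterModule.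
Implicit Types f g h : {additive R -> D}.

Lemma additive_funext (U V : zmodType) (f g : {additive U -> V}) :
  f =1 g -> f = g.
Proof.
case: f g => [f cf] [g cg] /= /funext fg; move: cf cg; rewrite -{g}fg => cf cg.
by congr (GRing.Additive.Pack _); case: cf cg => [[p]] [[p']]; rewrite (Prop_irrelevance p p').
Qed.

HB.instance Definition _ := gen_eqMixin {additive R -> D}.
HB.instance Definition _ := gen_choiceMixin {additive R -> D}.

Definition char_zero : {additive R -> D} := \0.
Definition char_opp f : {additive R -> D} := \- f.
Definition char_add f g : {additive R -> D} := f \+ g.
Definition char_scale (r : R) f : {additive R -> D} := f \o (r \*o idfun).

Lemma char_addA : associative char_add.
Proof. by move=> f g h; apply/additive_funext => x; exact: addrA. Qed.
Lemma char_addC : commutative char_add.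
Proof. by move=> f g; apply/additive_funext => x; exact: addrC. Qed.
Lemma char_add0 : left_id char_zero char_add.
Proof. by move=> f; apply/additive_funext => x; exact: add0r. Qed.
Lemma char_addN : left_inverse char_zero char_opp char_add.
Proof. by move=> f; apply/additive_funext => x; exact: addNr. Qed.
HB.instance Definition _ := GRing.isZmodule.Build {additive R -> D}
  char_addA char_addC char_add0 char_addN.

Lemma char_scaleA r s f : char_scale r (char_scale s f) = char_scale (r * s) f.
Proof. by apply/additive_funext => x /=; rewrite mulrCA mulrA. Qed.
Lemma char_scale1 : left_id 1 char_scale.
Proof. by move=> f; apply/additive_funext => x /=; rewrite mul1r. Qed.
Lemma char_scaleDr : right_distributive char_scale +%R.
Proof. by move=> r f g; apply/additive_funext. Qed.
Lemma char_scaleDl f : {morph char_scale^~ f : r s / r + s}.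
Proof. by move=> r s; apply/additive_funext => x /=; rewrite mulrDl raddfD. Qed.
HB.instance Definition _ := GRing.Zmodule_isLmodule.Build R {additive R -> D}
  char_scaleA char_scale1 char_scaleDr char_scaleDl.

End CharacterModule.

Definition coinduced (X : lmodType R) : lmodType R :=
  {additive X -> D} -> {additive R -> D}.

Lemma coinduced_injective X : injective_module (coinduced X).
Proof.
move=> A B i f i_inj.
have extj (j : {additive X -> D}) :
    exists g : {additive B -> D}, forall x, g (i x) = f x j 1.
  pose G := [set (i x, f x j 1) | x in [set: A]].
  have [|g gP] := @divisible_extension B _ rat_mod_int_divisible G.
    split; first by exists 0; rewrite // !linear0.
      move=> _ _ _ _ [x _ [<- <-]] [y _ [<- <-]].
      by exists (x - y); rewrite // !linearB.
    move=> d [x _ [ix <-]].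
    have -> : x = 0 by apply: i_inj; rewrite ix linear0.
    by rewrite linear0.
  by exists g => x; apply: gP; exists x.
have [g gP] := choice extj.
pose hfun (b : B) (j : {additive X -> D}) (s : R) : D := g j (s *: b).
have hadd b j : zmod_morphism (hfun b j).
  by move=> s t; rewrite /hfun scalerBl raddfB.
pose hadd' b j : {additive R -> D} :=
  HB.pack (hfun b j) (GRing.isZmodMorphism.Build _ _ _ (hadd b j)).
have hlin : linear (hadd' : B -> coinduced X).
  move=> r x y; apply/funext => j; apply/additive_funext => s /=.
  by rewrite /hfun scalerDr raddfD scalerA mulrC.
pose h : {linear B -> coinduced X} :=
  HB.pack (hadd' : B -> coinduced X) (GRing.isLinear.Build _ _ _ _ _ hlin).
exists h => x.
apply/funext => j; apply/additive_funext => s /=.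
by rewrite /hfun -linearZ gP linearZ /= mulr1.
Qed.

Section Embedding.
Variable X : lmodType R.

Definition coinduced_embed_fun (x : X) (j : {additive X -> D}) (s : R) : D :=
  j (s *: x).
Lemma coinduced_embed_fun_is_zmod_morphism x j : zmod_morphism (coinduced_embed_fun x j).
Proof. by move=> s t; rewrite /coinduced_embed_fun scalerBl raddfB. Qed.
HB.instance Definition _ x j := GRing.isZmodMorphism.Build R D
  (coinduced_embed_fun x j) (coinduced_embed_fun_is_zmod_morphism x j).

Definition coinduced_embed (x : X) : coinduced X := fun j => coinduced_embed_fun x j.
Lemma coinduced_embed_is_linear : linear coinduced_embed.
Proof.
move=> r x y; apply/funext => j; apply/additive_funext => s /=.
by rewrite /coinduced_embed_fun scalerDr raddfD scalerA mulrC.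
Qed.
HB.instance Definition _ :=
  GRing.isLinear.Build R X (coinduced X) _ coinduced_embed coinduced_embed_is_linear.

Lemma coinduced_embed_inj : injective coinduced_embed.
Proof.
move=> x y xy; apply/eqP; rewrite -subr_eq0; apply/negPn/negP.
move=> /rat_mod_int_separates[j /eqP[]].
have := congr1 (fun h : coinduced X => h j 1) xy.
by rewrite /= /coinduced_embed_fun !scale1r raddfB => ->; rewrite subrr.
Qed.

Definition coinduced_quot : lmodType R := quot_module (im coinduced_embed).

End Embedding.

Section Resolution.
Variable X : lmodType R.

Fixpoint cosyzygy (n : nat) : lmodType R :=
  if n is m.+1 then coinduced_quot (cosyzygy m) else X.

Definition cosyzygy_obj (n : nat) : lmodType R := coinduced (cosyzygy n).

Definition cosyzygy_diff (n : nat) :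
    {linear cosyzygy_obj n -> cosyzygy_obj n.+1} :=
  @coinduced_embed (cosyzygy n.+1) \o quot_proj (im (@coinduced_embed (cosyzygy n))).

Lemma ker_cosyzygy_diff n :
  carrier (ker (cosyzygy_diff n)) = carrier (im (@coinduced_embed (cosyzygy n))).
Proof.
apply/seteqP; split=> y /=.
  rewrite -(linear0 (@coinduced_embed (cosyzygy n.+1))) => /coinduced_embed_inj.
  by rewrite -(linear0 (quot_proj _)) => /quot_projP; rewrite subr0.
move=> yE; suff -> : quot_proj (im (@coinduced_embed (cosyzygy n))) y = 0.
  exact: linear0.
by rewrite -(linear0 (quot_proj _)); apply/quot_projP; rewrite subr0.
Qed.

Lemma ker_cosyzygy_diffS n :
  carrier (ker (cosyzygy_diff n.+1)) = carrier (im (cosyzygy_diff n)).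
Proof.
rewrite ker_cosyzygy_diff; apply/seteqP; split=> _ [x _ <-].
  by exists (repr x) => //; rewrite /cosyzygy_diff /= quot_projK.
by exists (quot_proj (im (@coinduced_embed (cosyzygy n))) x).
Qed.

Definition standard_resolution : injective_resolution X :=
  @InjectiveResolution R X cosyzygy_obj (@coinduced_embed X) cosyzygy_diff
    (fun n => coinduced_injective (X := cosyzygy n)) (@coinduced_embed_inj X)
    (ker_cosyzygy_diff 0) ker_cosyzygy_diffS.

End Resolution.
End EnoughInjectives.

(* Main.v *)
Require Import Defs.
From HB Require Import structures.
From mathcomp Require Import all_boot all_algebra.
From mathcomp Require Import boolp classical_sets functions cardinality.

(** Fix a prime p and argue up to elements outside p, so that V_p = 0 reads:
    every element of V is killed by some s outside p ([vanishes]).  Put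
    L = M / aM, and consider the finitely generated modules N on which every
    element of ann L acts locally nilpotently; they contain L and all the
    M / a^k M, and are stable under submodules and quotients.

    The heart is a change of module ([vanishes_nil_lt]): if Ext^i(L, X)_p = 0
    for all i < n, then Ext^i(N, X)_p = 0 for all i < n and all such N.  By
    induction on the degree, T = Ext^i(-, X)_p is left exact on these modules,
    so it vanishes on every quotient of L, and it is half exact, which leaves
    the cyclic N = Rx to treat.  Noetherian induction on ann x reduces to
    q = ann x prime.  Then q contains ann L, so there is a nonzero map from L
    to Rx ([map_to_cyclic]); T kills its image, a quotient of L, and kills the
    cokernel, whose annihilator is larger than q.

    If p is not in Supp Ext^i(L, X) for any i < n, it follows that the kernels
    of the surjections between modules N do not contribute, so that
    Ext^n(-, X)_p is left exact and the transition maps of the direct system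
    defining H^n_a(M, X) are injective at p ([transition_inj]).  In particular
    H^i_a(M, X)_p = 0 for all i < n if and only if Ext^i(L, X)_p = 0 for all
    i < n ([vanishes_ext_limit]), which gives the two descriptions of P_n.

    An element of Ext^n(L, X) with annihilator p keeps this annihilator in the
    limit ([Ass_ext_limit]).  Conversely let p be the annihilator of a class
    coming from Ext^n(M / a^k M, X).  Since p kills it, left exactness makes it
    come from a quotient N of M / a^k M killed by p, locally at p
    ([cocycle_factor_killed]).  Some power of each element of a kills
    M / a^k M, so a is contained in p and M -> N factors through L; pulling
    back to L gives a class of Ext^n(L, X) with annihilator p
    ([Ass_limit_ext]). *)

Set Implicit Arguments.
Unset Strict Implicit.
Unset Printing Implicit Defensive.
Import GRing.Theory.
Local Open Scope classical_set_scope.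
Local Open Scope ring_scope.

(** * Submodules, quotients and finite generation *)

Section Modules.
Variable R : comNzRingType.
Implicit Types U V W N : lmodType R.

Definition onto U V (f : {linear U -> V}) := forall y, exists x, f x = y.

Lemma factor_onto U V W (pi : {linear U -> V}) (f : {linear U -> W}) :
  onto pi -> (forall x, pi x = 0 -> f x = 0) ->
  exists g : {linear V -> W}, forall x, g (pi x) = f x.
Proof.
move=> surj fker; have [h hK] := choice surj.
have fE x y : pi x = pi y -> f x = f y.
  move=> e; apply/subr0_eq; rewrite -linearB; apply: fker.
  by rewrite linearB e subrr.
have lin : linear (f \o h).
  by move=> r x y /=; rewrite -linearP; apply: fE; rewrite linearP !hK.
pose g : {linear V -> W} :=
  HB.pack (f \o h) (GRing.isLinear.Build _ _ _ _ _ lin).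
by exists g => x; apply: fE; rewrite hK.
Qed.

Definition sub_incl V (K : submodule V) : {linear sub_module K -> V} := \val.

Lemma sub_incl_inj V (K : submodule V) : injective (sub_incl K).
Proof. exact: val_inj. Qed.

Lemma sub_inclP V (K : submodule V) (x : sub_module K) : carrier K (sub_incl K x).
Proof. by have := valP x; rewrite inE. Qed.

Lemma sub_incl_onto V (K : submodule V) x :
  carrier K x -> exists y : sub_module K, sub_incl K y = x.
Proof.
move=> Kx; have xK : x \in mem_submodule K by rewrite unfold_in /mem_submodule inE.
by exists (Sub x xK).
Qed.

Lemma quot_proj_eq0 V (K : submodule V) x : quot_proj K x = 0 <-> carrier K x.
Proof. by rewrite -(linear0 (quot_proj K)) quot_projP subr0. Qed.

Lemma quot_proj_onto V (K : submodule V) : onto (quot_proj K).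
Proof. by move=> u; exists (repr u); exact: quot_projK. Qed.

Lemma submoduleB V (K : submodule V) x y :
  carrier K x -> carrier K y -> carrier K (x - y).
Proof.
have [_ KD KZ] := carrierP K => Kx Ky.
by apply: KD => //; rewrite -scaleN1r; exact: KZ.
Qed.

Lemma preim_is_sub V W (f : {linear V -> W}) (K : submodule W) :
  is_submodule [set x | carrier K (f x)].
Proof.
have [K0 KD KZ] := carrierP K; split=> /= [|x y ? ?|r x ?].
- by rewrite linear0.
- by rewrite linearD; exact: KD.
- by rewrite linearZ; exact: KZ.
Qed.

Definition scalar_map V (r : R) : {linear V -> V} := r \*: idfun.

Lemma line_is_linear V (x : V) : linear (fun r : R^o => r *: x).
Proof. by move=> k r s; rewrite scalerDl scalerA. Qed.
Definition line_map V (x : V) : {linear R^o -> V} :=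
  HB.pack (fun r : R^o => r *: x) (GRing.isLinear.Build _ _ _ _ _ (line_is_linear x)).

Lemma range_onto U V (f : {linear U -> V}) :
  exists g : {linear U -> sub_module (im f)},
    onto g /\ forall x, sub_incl (im f) (g x) = f x.
Proof.
have e x : exists y : sub_module (im f), sub_incl (im f) y = f x.
  by apply: sub_incl_onto; exists x.
have [h hK] := choice e.
have lin : linear h.
  by move=> r x y; apply: (@sub_incl_inj _ (im f)); rewrite linearP !hK linearP.
pose g : {linear U -> sub_module (im f)} :=
  HB.pack h (GRing.isLinear.Build _ _ _ _ _ lin).
exists g; split=> // y; have [x _ fx] := sub_inclP y.
by exists x; apply: (@sub_incl_inj _ (im f)); rewrite hK.
Qed.

(** Generation by a list, phrased as an induction principle over submodules;
    unlike membership in a finite set, it supports recursion on the list. *)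
Definition spanned V (xs : seq V) := forall S : submodule V,
  {in xs, forall x, carrier S x} -> forall v, carrier S v.

Lemma finitely_generated_spanned V :
  finitely_generated V -> exists xs : seq V, spanned xs.
Proof.
move=> [A /finite_seqP [xs ->] eqA]; exists xs => S xsS v.
have : carrier (generated [set` xs]) v by rewrite -eqA.
by apply => /=; split; [exact: carrierP|].
Qed.

Lemma spanned_onto U V (f : {linear U -> V}) xs :
  onto f -> spanned xs -> spanned (map f xs).
Proof.
move=> fs sp S fxS v; have [u <-] := fs v.
apply: (sp (Submodule (preim_is_sub f S))) => x xxs; apply: fxS; exact: map_f.
Qed.

Lemma line_cyclic (N : lmodType R) (x : N) :
  exists x' : sub_module (im (line_map x)), sub_incl _ x' = x /\
    forall y, exists r, r *: x' = y.
Proof.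
have [g [g_onto gE]] := range_onto (line_map x); exists (g (1 : R^o)).
split; first by rewrite gE; exact: scale1r.
move=> y; have [r <-] := g_onto y; exists r.
by rewrite -linearZZ; congr (g _); exact: mulr1.
Qed.

Lemma spanned_quot_line (N : lmodType R) (x : N) xs : spanned (x :: xs) ->
  spanned (map (quot_proj (im (line_map x))) xs).
Proof.
move=> spN S xsS; apply: (spanned_onto (@quot_proj_onto _ _) spN).
move=> y; rewrite inE => /orP[/eqP ->|]; last exact: xsS.
have e0 : quot_proj (im (line_map x)) x = 0.
  by apply/quot_proj_eq0; exists 1 => //; exact: scale1r.
have [S0 _ _] := carrierP S.
by have : carrier S (quot_proj (im (line_map x)) x) by rewrite e0.
Qed.

Lemma im_is_sub V W (f : {linear V -> W}) (K : submodule V) :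
  is_submodule (f @` carrier K).
Proof.
have [K0 KD KZ] := carrierP K.
split=> [|_ _ [x Kx <-] [y Ky <-]|r _ [x Kx <-]].
- by exists 0 => //; exact: linear0.
- by exists (x + y); [exact: KD|exact: linearD].
- by exists (r *: x); [exact: KZ|rewrite linearZ].
Qed.

Lemma setI_is_sub V (K S : submodule V) : is_submodule (carrier K `&` carrier S).
Proof.
have [K0 KD KZ] := carrierP K; have [S0 SD SZ] := carrierP S.
by split=> [|x y [? ?] [? ?]|r x [? ?]]; split; auto.
Qed.

Lemma noetherian_ideal (noethR : noetherian_ring R) (I : ideal R) :
  exists rs : seq R, {in rs, forall r, carrier I r} /\
    forall I' : ideal R, {in rs, forall r, carrier I' r} -> carrier I `<=` carrier I'.
Proof.
have [A /finite_seqP [rs ->] eqA] := noethR I; exists rs; split.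
  by move=> r rrs; rewrite eqA; exact: sub_gen_smallest.
by move=> I' rsI'; rewrite eqA; apply: smallest_sub => //; exact: carrierP.
Qed.

(** Induction on the number of generators x, x1, ..., xm of V: K is generated
    by lifts of generators of its image in V / Rx, together with the r x for r
    in generators of the ideal of all r with r x in K. *)
Lemma noetherian_submodule (noethR : noetherian_ring R) V (xs : seq V) :
  spanned xs -> forall K : submodule V, exists ys : seq (sub_module K), spanned ys.
Proof.
move=> spV K.
suff [zs [zsK spz]] : exists zs : seq V, {in zs, forall z, carrier K z} /\
    forall S : submodule V, {in zs, forall z, carrier S z} -> carrier K `<=` carrier S.
  have [ys zsE] : exists ys : seq (sub_module K), map (sub_incl K) ys = zs.
    elim: zs zsK {spz} => [|z zs IH] zsK; first by exists [::].
    have [|ys <-] := IH; first by move=> x xzs; apply: zsK; rewrite inE xzs orbT.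
    have [y <-] := sub_incl_onto (zsK z (mem_head _ _)).
    by exists (y :: ys).
  exists ys => S ysS v.
  have [|w Sw /sub_incl_inj <-//] :=
    spz (Submodule (im_is_sub (sub_incl K) S)) _ _ (sub_inclP v).
  by rewrite -zsE => _ /mapP [y yys ->]; exists y => //; exact: ysS.
have [m] := ubnP (size xs).
elim: m => // m IH in V xs spV K *; case: xs spV => [|x xs] spV /= szxs.
  exists [::]; split=> // S _ v _; have: carrier (zero_submodule V) v by exact: spV.
  by move=> ->; have [] := carrierP S.
pose Q := im (line_map x); pose pr := quot_proj Q.
have spQ : spanned (map pr xs) := spanned_quot_line spV.
have [|us [usK spu]] := IH _ _ spQ (Submodule (im_is_sub pr K)).
  by rewrite size_map.
have [zs [zsK usE]] : exists zs, {in zs, forall z, carrier K z} /\ map pr zs = us.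
  elim: us usK {spu} => [|u us IHu] usK; first by exists [::].
  have [|zs [zsK <-]] := IHu; first by move=> y yus; apply: usK; rewrite inE yus orbT.
  have [z Kz <-] := usK u (mem_head _ _); exists (z :: zs); split=> // y.
  by rewrite inE => /orP[/eqP ->//|]; exact: zsK.
pose I : ideal R := Submodule (preim_is_sub (line_map x) K).
have [rs [rsI spI]] := noetherian_ideal noethR I.
exists (zs ++ map (line_map x) rs); split=> [y|S yS k Kk].
  by rewrite mem_cat => /orP[|/mapP [r rrs ->]]; [exact: zsK|exact: rsI].
have [SI0 SID SIZ] := carrierP S.
have [||s [Ks Ss] /eqP] :=
    spu (Submodule (im_is_sub pr (Submodule (setI_is_sub K S)))) _ (pr k).
- move=> u; rewrite -usE => /mapP [z zzs ->]; exists z => //.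
  by split; [exact: zsK|apply: yS; rewrite mem_cat zzs].
- by exists k.
rewrite eq_sym -subr_eq0 -linearB => /eqP/quot_proj_eq0 [r _ rx].
rewrite -(subrK s k) -rx; apply: SID => //.
apply: (spI (Submodule (preim_is_sub (line_map x) S))) => [t trs|].
  by apply: yS; rewrite mem_cat map_f ?orbT.
by have := submoduleB Kk Ks; rewrite -rx.
Qed.
End Modules.

(** * Noetherian induction and maps to cyclic modules *)

Section NoetherianInduction.
Variable R : comNzRingType.
Implicit Types U V W N : lmodType R.

(** A counterexample would have a strictly larger one, and so on; the union of
    the resulting chain is an ideal, whose finitely many generators already
    lie in one member of the chain. *)
Lemma noetherian_ind (noethR : noetherian_ring R) (Q : ideal R -> Prop) :
  (forall I : ideal R,
     (forall I' : ideal R, carrier I `<=` carrier I' ->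
        (exists2 r, carrier I' r & ~ carrier I r) -> Q I') -> Q I) ->
  forall I, Q I.
Proof.
move=> step I; apply: contrapT => nQI.
have larger (T : {I : ideal R | ~ Q I}) : exists T' : {I : ideal R | ~ Q I},
    carrier (sval T) `<=` carrier (sval T') /\
    exists2 r, carrier (sval T') r & ~ carrier (sval T) r.
  apply: contrapT => nT; apply: (svalP T); apply: step => I' II' I'r.
  by apply: contrapT => nQI'; apply: nT; exists (exist _ I' nQI').
have [next nextP] := choice larger.
pose C k : ideal R := sval (iter k next (exist _ I nQI)).
have C_le j k : (j <= k)%N -> carrier (C j) `<=` carrier (C k).
  move=> /subnKC <-; elim: (k - j)%N => [|m IH]; first by rewrite addn0.
  rewrite addnS; apply: subset_trans IH _.
  by have [] := nextP (iter (j + m) next (exist _ I nQI)).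
have UP : is_submodule (fun r : R^o => exists k, carrier (C k) r).
  split=> [|x y [j Cx] [k Cy]|r x [k Cx]].
  - by exists 0%N; have [] := carrierP (C 0%N).
  - exists (maxn j k); have [_ CD _] := carrierP (C (maxn j k)).
    by apply: CD; [apply: C_le Cx|apply: C_le Cy]; rewrite ?leq_maxl ?leq_maxr.
  - by exists k; have [_ _ CZ] := carrierP (C k); exact: CZ.
have [rs [rsU spU]] := noetherian_ideal noethR (Submodule UP).
have [K rsK] : exists K, {in rs, forall r, carrier (C K) r}.
  elim: rs rsU {spU} => [|r rs IH] rsU; first by exists 0%N.
  have [|K rsK] := IH; first by move=> t trs; apply: rsU; rewrite inE trs orbT.
  have [k Ck] := rsU r (mem_head _ _); exists (maxn K k) => t.
  rewrite inE => /orP[/eqP ->|/rsK]; [apply: C_le Ck; exact: leq_maxr|].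
  by apply: C_le; exact: leq_maxl.
have [_ [r Cr]] := nextP (iter K next (exist _ I nQI)).
by apply; apply: (spU _ rsK); exists K.+1.
Qed.

(** For V finitely generated with V_q nonzero, there is a nonzero map from V to
    R / q, here the cyclic module N = Rx.  Let y be a generator of V.  If ann
    (V / Ry) is still contained in q, a map from V / Ry obtained by induction
    will do.  Otherwise s V lies in Ry for some s outside q, and v |-> r x,
    where s v = r y, works: it is well defined because s ann y kills V, so
    that ann y is contained in q, and it sends y to s x. *)
Lemma map_to_cyclic N (x : N) (q : set R) : prime_ideal q ->
  (forall r, q r <-> r *: x = 0) ->
  forall V (ys : seq V), spanned ys ->
    (forall r, (forall v : V, r *: v = 0) -> q r) ->
  exists (f : {linear V -> N}) (v : V), f v != 0.
Proof.
move=> [[q0 qD qZ] q1 qM] qx V ys; have [m] := ubnP (size ys).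
elim: m => // m IH in V ys *; case: ys => [|y ys] /= szys spV annV.
  case: q1; apply: annV => v; suff -> : v = 0 by rewrite scaler0.
  by apply: (spV (zero_submodule V)).
pose Q := im (line_map y); pose pr := quot_proj Q.
have spQ : spanned (map pr ys) := spanned_quot_line spV.
have [annQ|] := pselect (forall r, (forall w : quot_module Q, r *: w = 0) -> q r).
  have [|f [w fw]] := IH _ _ _ spQ annQ; first by rewrite size_map.
  have [v vw] := quot_proj_onto w.
  by exists (f \o quot_proj Q), v; rewrite /= vw.
move=> /existsNP [s /not_implyP [sQ qs]].
have /choice [h hE] : forall v : V, exists r : R, s *: v = r *: y.
  move=> v; have /quot_proj_eq0 [r _ ry] : quot_proj Q (s *: v) = 0.
    by rewrite linearZ; exact: sQ.
  by exists r.
have wd r r' : r *: y = r' *: y -> r *: x = r' *: x.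
  move=> e; apply/subr0_eq; rewrite -scalerBl; apply/qx.
  suff /qM [//|] : q ((r - r') * s) by [].
  apply: annV => v; rewrite -scalerA hE scalerA mulrC -scalerA scalerBl e subrr.
  by rewrite scaler0.
have lin : linear (fun v : V => h v *: x).
  move=> k v w; rewrite scalerA -scalerDl; apply: wd.
  by rewrite -hE scalerDl -scalerA -!hE scalerDr !scalerA mulrC.
pose f : {linear V -> N} :=
  HB.pack (fun v : V => h v *: x) (GRing.isLinear.Build _ _ _ _ _ lin).
exists f, y; apply/eqP => /=; rewrite -(wd s); last by rewrite hE.
by move/qx.
Qed.
End NoetherianInduction.

Lemma prime_exp (R : comNzRingType) (q : set R) r m : prime_ideal q -> q (r ^+ m) -> q r.
Proof.
by case=> _ q1 qM; elim: m => [/q1//|m IH]; rewrite exprS => /qM [|/IH].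
Qed.

(** * Ext groups up to localization at a prime *)

Section LocalVanishing.
Variables (R : comNzRingType) (p : set R).
Hypothesis prime_p : prime_ideal p.

(** The condition V_p = 0. *)
Definition vanishes (V : lmodType R) := forall x : V, exists2 s, ~ p s & s *: x = 0.

Lemma not_prime1 : ~ p 1. Proof. by case: prime_p. Qed.
Lemma not_primeM s t : ~ p s -> ~ p t -> ~ p (s * t).
Proof. by case: prime_p => _ _ pM ps pt /pM []. Qed.

Lemma Supp_vanishes V : Supp V p <-> ~ vanishes V.
Proof.
split=> [[_ [x [s [ps nfrac]]]] van|].
  have [u pu ux] := van x; apply: nfrac; exists u => //.
  by rewrite scaler0 subr0 scale1r.
move=> /existsNP [x xP]; split=> //; exists x, 1; split; first exact: not_prime1.
by move=> [u pu]; rewrite scaler0 subr0 scale1r => ux; apply: xP; exists u.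
Qed.

Variables (X : lmodType R) (J : injective_resolution X).
Implicit Types N K : lmodType R.

Lemma homB N i (f g : {linear N -> J i}) x : (f - g) x = f x - g x.
Proof. by []. Qed.
Lemma homZ N i r (f : {linear N -> J i}) x : (r *: f) x = r *: f x.
Proof. by []. Qed.

Lemma precompZ N N' (phi : {linear N -> N'}) i r (f : {linear N' -> J i}) :
  precomp phi (r *: f) = r *: precomp phi f.
Proof. exact/linear_funext. Qed.

Lemma cocycleP N i (f : {linear N -> J i}) :
  carrier (cocycles J N i) f <-> forall x, res_diff J i (f x) = 0.
Proof.
split=> [df x|df]; last exact/linear_funext.
by have /(congr1 (fun h : {linear _ -> _} => h x)) := df.
Qed.

Lemma coboundary_cocycle N i (f : {linear N -> J i}) :
  carrier (coboundaries J N i) f -> carrier (cocycles J N i) f.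
Proof.
case: i f => [f /= ->|i f [h _ <-]]; apply/cocycleP => x; first exact: linear0.
suff : carrier (ker (res_diff J i.+1)) (res_diff J i (h x)) by [].
by rewrite res_exactS; exists (h x).
Qed.

(** This is where injectivity of the J i enters: coboundaries on a submodule
    extend to coboundaries on the whole module. *)
Lemma coboundary_extend N N' i (e : {linear N' -> N}) (c : {linear N' -> J i}) :
  injective e -> carrier (coboundaries J N' i) c ->
  exists2 c' : {linear N -> J i}, carrier (coboundaries J N i) c' & precomp e c' = c.
Proof.
move=> e_inj; case: i c => [c /= ->|i c [h _ <-]].
  by exists 0 => //; apply/linear_funext.
have [h' h'E] := res_obj_injective h e_inj.
exists (postcomp (res_diff J i) h'); first by exists h'.
by apply/linear_funext => x /=; rewrite h'E.
Qed.

(** Relating classes to their cocycles by a predicate avoids choosing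
    representatives in the nested quotient that defines Ext. *)
Definition is_class N i (f : {linear N -> J i}) (u : Ext J i N) :=
  exists2 z : sub_module (cocycles J N i), sub_incl (cocycles J N i) z = f &
    u = quot_proj _ z.

Lemma class_repr N i (u : Ext J i N) : exists f, is_class f u.
Proof.
exists (sub_incl (cocycles J N i) (repr u)).
by exists (repr u); rewrite ?quot_projK.
Qed.

Lemma class_cocycle N i f (u : Ext J i N) : is_class f u -> carrier (cocycles J N i) f.
Proof. by move=> [z <- _]; exact: sub_inclP. Qed.

Lemma cocycle_class N i (f : {linear N -> J i}) :
  carrier (cocycles J N i) f -> exists u, is_class f u.
Proof. by move=> /sub_incl_onto [z zf]; exists (quot_proj _ z); exists z. Qed.

Lemma class_eq0 N i f (u : Ext J i N) :
  is_class f u -> u = 0 <-> carrier (coboundaries J N i) f.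
Proof. by move=> [z <- ->]; rewrite quot_proj_eq0. Qed.

Lemma classZ N i r f (u : Ext J i N) : is_class f u -> is_class (r *: f) (r *: u).
Proof. by move=> [z <- ->]; exists (r *: z); rewrite linearZ. Qed.

Lemma class_map N N' (phi : {linear N -> N'}) i f (u : Ext J i N') :
  is_class f u -> is_class (precomp phi f) (Ext_map J phi i u).
Proof.
move=> [z <- ->]; exists (Defs.sub_map (@precomp_cocycles R X J N N' phi i) z) => //.
exact: quot_mapE.
Qed.

Lemma vanishes_ext N i : vanishes (Ext J i N) <->
  forall f, carrier (cocycles J N i) f ->
    exists2 s, ~ p s & carrier (coboundaries J N i) (s *: f).
Proof.
split=> [van f /cocycle_class [u fu]|bnd u].
  have [s ps su] := van u; exists s => //; exact/(class_eq0 (classZ s fu)).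
have [f fu] := class_repr u; have [s ps bf] := bnd f (class_cocycle fu).
by exists s => //; exact/(class_eq0 (classZ s fu)).
Qed.

(** The part Ext^(i-1)(ker pi) -> Ext^i(N'') -> Ext^i(N) of the long exact
    sequence, at p.  If g pi = d h, then h restricts to a cocycle on ker pi,
    which after multiplication by some s bounds; correcting s h by an extension
    of the bounding cochain makes it descend to N'', where it bounds s g. *)
Lemma ext_inj N N'' (pi : {linear N -> N''}) i (g : {linear N'' -> J i}) :
  onto pi ->
  (forall j, i = j.+1 -> vanishes (Ext J j (sub_module (ker pi)))) ->
  carrier (coboundaries J N i) (precomp pi g) ->
  exists2 s, ~ p s & carrier (coboundaries J N'' i) (s *: g).
Proof.
move=> pi_onto; case: i g => [g _ /= g0|i g van [h _ hE]].
  exists 1; first exact: not_prime1.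
  rewrite scale1r; apply/linear_funext => y; have [x <-] := pi_onto y.
  by have /(congr1 (fun h : {linear _ -> _} => h x)) := g0.
have {}hE x : res_diff J i (h x) = g (pi x).
  by have /(congr1 (fun h : {linear _ -> _} => h x)) := hE.
pose e := sub_incl (ker pi).
have [|s ps hs] := (vanishes_ext _ _).1 (van i erefl) (precomp e h).
  by apply/cocycleP => x /=; rewrite hE (sub_inclP x) linear0.
have [k kc kE] := coboundary_extend (@sub_incl_inj _ _ (ker pi)) hs.
have [x xpi|h' h'E] := @factor_onto _ _ _ _ pi (s *: h - k) pi_onto.
  have [y <-] := sub_incl_onto (xpi : carrier (ker pi) x).
  have ky : k (e y) = s *: h (e y) := congr1 (fun h : {linear _ -> _} => h y) kE.
  by rewrite homB homZ ky; exact: subrr.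
exists s => //; exists h' => //; apply/linear_funext => y.
have [x <-] := pi_onto y; rewrite /= h'E homB linearB.
have /cocycleP -> := coboundary_cocycle kc.
by rewrite subr0 homZ linearZ hE.
Qed.

(** Exactness of Ext^i(N / K) -> Ext^i(N) -> Ext^i(K) in the middle: subtract
    from f a coboundary on N with the same restriction to K. *)
Lemma ext_descend N (K : submodule N) i (f : {linear N -> J i}) :
  carrier (cocycles J N i) f ->
  carrier (coboundaries J _ i) (precomp (sub_incl K) f) ->
  exists2 g, carrier (cocycles J (quot_module K) i) g &
    carrier (coboundaries J N i) (f - precomp (quot_proj K) g).
Proof.
move=> /cocycleP fc /(coboundary_extend (@sub_incl_inj _ _ K)) [c cb cE].
have [x xK|g gE] := @factor_onto _ _ _ _ (quot_proj K) (f - c) (@quot_proj_onto _ _ K).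
  have [y <-] := sub_incl_onto ((quot_proj_eq0 _ _).1 xK).
  have cy : c (sub_incl K y) = f (sub_incl K y) :=
    congr1 (fun h : {linear _ -> _} => h y) cE.
  by rewrite homB cy; exact: subrr.
exists g.
  apply/cocycleP => y; have [x <-] := @quot_proj_onto _ _ K y.
  rewrite gE homB linearB fc; have /cocycleP -> := coboundary_cocycle cb.
  exact: subrr.
suff -> : f - precomp (quot_proj K) g = c by [].
by apply/linear_funext => x; rewrite homB /= gE homB subKr.
Qed.

Lemma ext_half_exact N (K : submodule N) i :
  vanishes (Ext J i (sub_module K)) -> vanishes (Ext J i (quot_module K)) ->
  vanishes (Ext J i N).
Proof.
move=> /vanishes_ext vK /vanishes_ext vQ; apply/vanishes_ext => f fc.
have [s ps fs] := vK _ (precomp_cocycles (sub_incl K) fc).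
have [_ _ CZ] := carrierP (cocycles J N i).
rewrite -precompZ in fs.
have [g gc gb] := ext_descend (CZ s _ fc) fs.
have [t pt gt] := vQ _ gc; exists (t * s); first exact: not_primeM.
have [_ BD BZ] := carrierP (coboundaries J N i).
have := BD _ _ (BZ t _ gb) (precomp_coboundaries (quot_proj K) gt).
by rewrite precompZ -scalerDr subrK scalerA.
Qed.

End LocalVanishing.

(** * Change of the first argument of Ext *)

Section TorsionClass.
Variables (R : comNzRingType) (noethR : noetherian_ring R).
Implicit Types (N : lmodType R) (b : set R).
Variables (p : set R) (prime_p : prime_ideal p).
Variables (X : lmodType R) (J : injective_resolution X).

(** With b = ann L and L finitely generated, these are the finitely generated N
    with Supp N contained in Supp L; local nilpotence avoids all mention of
    supports and is visibly inherited by submodules and quotients. *)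
Definition nil_fg (b : set R) (N : lmodType R) :=
  (exists xs : seq N, spanned xs) /\
  (forall r, b r -> forall x : N, exists m, r ^+ m *: x = 0).

Lemma nil_fg_sub b N (K : submodule N) : nil_fg b N -> nil_fg b (sub_module K).
Proof.
move=> [[xs sp] nil]; split; first exact: noetherian_submodule sp K.
move=> r br x; have [m mx] := nil r br (sub_incl K x); exists m.
by apply: (@sub_incl_inj _ _ K); rewrite linearZZ mx linear0.
Qed.

Lemma nil_fg_onto b N N' (f : {linear N -> N'}) : onto f -> nil_fg b N -> nil_fg b N'.
Proof.
move=> f_onto [[xs sp] nil]; split; first by exists (map f xs); exact: spanned_onto.
move=> r br y; have [x <-] := f_onto y; have [m mx] := nil r br x; exists m.
by rewrite -linearZZ mx linear0.
Qed.

Lemma nil_fg_quot b N (K : submodule N) : nil_fg b N -> nil_fg b (quot_module K).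
Proof. exact/nil_fg_onto/quot_proj_onto. Qed.

Lemma vanishes_ext0 (N : lmodType R) i : (forall y : N, y = 0) -> vanishes p (Ext J i N).
Proof.
move=> N0; apply/vanishes_ext => f _; exists 1; first exact: not_prime1.
have -> : 1 *: f = 0 by apply/linear_funext => y; rewrite (N0 y) !linear0.
by have [] := carrierP (coboundaries J N i).
Qed.

Section Below.
Variables (b : set R) (i : nat).
(* The hypothesis concerns degree i - 1, and is empty for i = 0. *)
Hypothesis ext_vanishes_below : forall j, i = j.+1 ->
  forall N, nil_fg b N -> vanishes p (Ext J j N).

Lemma ext_inj_nil N N'' (pi : {linear N -> N''}) (g : {linear N'' -> J i}) :
  onto pi -> nil_fg b N -> carrier (coboundaries J N i) (precomp pi g) ->
  exists2 s, ~ p s & carrier (coboundaries J N'' i) (s *: g).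
Proof.
move=> pi_onto bN; apply: ext_inj => // j /ext_vanishes_below; apply; exact: nil_fg_sub.
Qed.

Lemma vanishes_onto N N'' (pi : {linear N -> N''}) : onto pi -> nil_fg b N ->
  vanishes p (Ext J i N) -> vanishes p (Ext J i N'').
Proof.
move=> pi_onto bN /vanishes_ext van; apply/vanishes_ext => g gc.
have [s ps] := van _ (precomp_cocycles pi gc).
rewrite -precompZ => /(ext_inj_nil pi_onto bN) [t pt tsg].
by exists (t * s); [exact: not_primeM|rewrite -scalerA].
Qed.

(** One step of the induction on the degree.  By half exactness it is enough to
    treat cyclic modules N = Rx, and this is done by Noetherian induction on
    I = ann x. *)
Lemma vanishes_nil (L : lmodType R) : (exists xs : seq L, spanned xs) ->
  (b = [set r | forall y : L, r *: y = 0]) ->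
  vanishes p (Ext J i L) -> forall N, nil_fg b N -> vanishes p (Ext J i N).
Proof.
move=> [ls spL] bE vL.
have bL : nil_fg b L.
  by split; [exists ls|rewrite bE => r br x; exists 1%N; rewrite expr1].
suff cyclic : forall (I : ideal R) (N : lmodType R) (x : N),
    (forall r, carrier I r <-> r *: x = 0) ->
    (forall y, exists r, r *: x = y) -> nil_fg b N -> vanishes p (Ext J i N).
  move=> N bN; have [[xs spN] nilN] := bN; have [m] := ubnP (size xs).
  elim: m => // m IH in N bN xs spN {nilN} *; case: xs spN => [|x xs] spN /= szxs.
    by apply: vanishes_ext0 => y; apply: (spN (zero_submodule N)).
  have [x' [_ x'E]] := line_cyclic x.
  apply: (@ext_half_exact _ _ prime_p _ _ _ (im (line_map x))).
    by apply: (cyclic (ker (line_map x')) _ x') => //; exact: nil_fg_sub.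
  apply: (IH _ _ (map (quot_proj (im (line_map x))) xs)); last by rewrite size_map.
    exact: nil_fg_quot.
  exact: spanned_quot_line.
elim/(noetherian_ind noethR) => I IH N x Ix xE bN.
have [I1|I1] := pselect (carrier I 1).
  apply: vanishes_ext0 => y; have [r <-] := xE y.
  by move/Ix: I1; rewrite scale1r => ->; rewrite scaler0.
(* K contains a multiple r x with r outside I, so that N / K is cyclic with a
   strictly larger annihilator and only the submodule K remains. *)
have quot_step (K : submodule N) r : carrier K (r *: x) -> ~ carrier I r ->
    vanishes p (Ext J i (sub_module K)) -> vanishes p (Ext J i N).
  move=> Kr Ir vK; apply: (ext_half_exact prime_p vK).
  apply: (IH (ker (line_map (quot_proj K x))) _ _ _ (quot_proj K x)) => //.
  - by move=> t /Ix tx; rewrite /= -linearZZ tx linear0.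
  - by exists r => //=; rewrite -linearZZ; exact/quot_proj_eq0.
  - move=> y; have [z <-] := quot_proj_onto y; have [t <-] := xE z.
    by exists t; rewrite linearZZ.
  - exact: nil_fg_quot.
have [primeI|] := pselect (prime_ideal (carrier I)); last first.
  (* Both R y x and its quotient have a larger annihilator: the first is killed
     by z, the second by y. *)
  move=> nprime; have [y [z [Iyz [Iy Iz]]]] : exists y z : R, carrier I (y * z) /\
      ~ carrier I y /\ ~ carrier I z.
    apply: contrapT => H; apply: nprime; split=> //; first exact: carrierP.
    move=> y z Iyz; apply: contrapT => /not_orP [Iy Iz].
    by apply: H; exists y, z.
  have [x' [x'x x'E]] := line_cyclic (y *: x).
  apply: (quot_step (im (line_map (y *: x))) y) => //.
    by exists 1 => //; exact: scale1r.
  apply: (IH (ker (line_map x')) _ _ _ x') => //; last exact: nil_fg_sub.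
  - move=> t /Ix tx; apply: (@sub_incl_inj _ _ _ (t *: x') 0).
    by rewrite linear0 linearZZ x'x scalerA mulrC -scalerA tx scaler0.
  - exists z => //; apply: (@sub_incl_inj _ _ _ (z *: x') 0).
    by rewrite linear0 linearZZ x'x scalerA mulrC; exact/Ix.
(* Some power of r kills x, and I is prime. *)
have annL r : (forall v : L, r *: v = 0) -> carrier I r.
  move=> rL; have [m mx] := bN.2 r (eq_ind_r (fun c : set R => c r) rL bE) x.
  by apply: (prime_exp (m := m) primeI); exact/Ix.
have [f [v fv]] := map_to_cyclic primeI Ix spL annL.
have [r rx] := xE (f v).
have [g [g_onto _]] := range_onto f.
apply: (quot_step (im f) r); first by rewrite rx; exists v.
  by move=> /Ix rx0; rewrite -rx rx0 eqxx in fv.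
exact: vanishes_onto g_onto bL vL.
Qed.

(** Left exactness of T = Ext^i(-, X)_p gives
    T(N / rN) = ker (r : T(N) -> T(N)), because r : N -> N factors as a
    surjection N -> rN followed by the inclusion.  Dividing out one element of
    rs at a time, a class killed by all of rs at p comes from a quotient of N
    killed by rs. *)
Lemma cocycle_factor_killed (rs : seq R) (N : lmodType R) (f : {linear N -> J i}) :
  nil_fg b N -> carrier (cocycles J N i) f ->
  {in rs, forall r, exists2 s, ~ p s & carrier (coboundaries J N i) ((s * r) *: f)} ->
  exists (N' : lmodType R) (pi : {linear N -> N'}) (g : {linear N' -> J i}) (s : R),
    [/\ onto pi, {in rs, forall r y, r *: y = 0 :> N'},
        carrier (cocycles J N' i) g, ~ p s &
        carrier (coboundaries J N i) (s *: f - precomp pi g)].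
Proof.
elim: rs N f => [|r rs IH] N f bN fc frs.
  exists N, idfun, f, 1; split=> //; first by move=> y; exists y.
    exact: not_prime1.
  suff -> : 1 *: f - precomp idfun f = 0 by have [] := carrierP (coboundaries J N i).
  by apply/linear_funext => y; rewrite homB scale1r subrr.
pose K := im (scalar_map N r); pose q := quot_proj K.
have [BD BZ] : (forall f g, carrier (coboundaries J N i) f ->
    carrier (coboundaries J N i) g -> carrier (coboundaries J N i) (f + g)) /\
    (forall t f, carrier (coboundaries J N i) f -> carrier (coboundaries J N i) (t *: f)).
  by have [] := carrierP (coboundaries J N i).
have [rho [rho_onto rhoE]] := range_onto (scalar_map N r).
have [s ps srf] := frs r (mem_head _ _).
have [|t pt tK] := @ext_inj_nil _ _ rho (s *: precomp (sub_incl K) f) rho_onto bN.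
  suff -> : precomp rho (s *: precomp (sub_incl K) f) = (s * r) *: f by [].
  apply/linear_funext => y; rewrite -scalerA !homZ precompZ homZ; congr (s *: _).
  rewrite -[LHS]/(f (sub_incl K (rho y))) rhoE; exact: linearZZ.
rewrite scalerA -precompZ in tK; set s1 := t * s in tK.
have ps1 : ~ p s1 by exact: not_primeM.
have [_ _ CZ] := carrierP (cocycles J N i).
have [g gc gb] := ext_descend (CZ s1 _ fc) tK.
have [|r2 r2rs|N' [pi [h [s2 [pi_onto rsN' hc ps2 hb]]]]] := IH (quot_module K) g _ gc.
- exact: nil_fg_quot.
- have [s2 ps2 s2f] := frs r2 (mem_behead (r2rs : r2 \in behead (r :: rs))).
  have [|t2 pt2] := @ext_inj_nil _ _ q ((s2 * r2) *: g) (@quot_proj_onto _ _ K) bN.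
    have := submoduleB (BZ s1 _ s2f) (BZ (s2 * r2) _ gb).
    rewrite scalerBr !scalerA (mulrC s1) opprB addrCA subrr addr0.
    by rewrite precompZ.
  by rewrite scalerA mulrA => ?; exists (t2 * s2) => //; exact: not_primeM.
exists N', (pi \o q : {linear N -> N'}), h, (s2 * s1); split=> //.
- by move=> y; have [z <-] := pi_onto y; have [x <-] := quot_proj_onto z; exists x.
- move=> r2; rewrite inE => /orP[/eqP ->|]; last exact: rsN'.
  move=> y; have [z <-] := pi_onto y; have [x <-] := quot_proj_onto z.
  have rx0 : r *: quot_proj K x = 0.
    by rewrite -linearZZ; apply/quot_proj_eq0; exists x.
  by rewrite -linearZZ rx0 linear0.
- exact: not_primeM.
- have := BD _ _ (BZ s2 _ gb) (precomp_coboundaries q hb).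
  congr (carrier _ _); apply/linear_funext => y.
  rewrite -[LHS]/(s2 *: (s1 *: f y - g (q y)) + (s2 *: g (q y) - h (pi (q y)))).
  by rewrite scalerBr scalerA subrKA.
Qed.

End Below.

Lemma vanishes_nil_lt (L : lmodType R) n : (exists xs : seq L, spanned xs) ->
  (forall i, (i < n)%N -> vanishes p (Ext J i L)) ->
  forall i, (i < n)%N -> forall N, nil_fg [set r | forall y : L, r *: y = 0] N ->
  vanishes p (Ext J i N).
Proof.
move=> fgL vL; elim=> [|i IH] lt_in N bN.
  by apply: vanishes_nil fgL erefl (vL _ lt_in) _ bN.
apply: vanishes_nil fgL erefl (vL _ lt_in) _ bN => _ [<-].
by apply: IH; exact: ltnW.
Qed.
End TorsionClass.

(** * Sequential direct limits *)

Section DirectLimitStages.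
Variables (R : comNzRingType) (E : nat -> lmodType R).
Variable t : forall k, {linear E k -> E k.+1}.
Implicit Types (x : dprod E) (u : direct_limit t).

(** A class in the direct limit is represented by a finitely supported sequence
    x; psum x k transports x 0, ..., x k to stage k and adds them there.  It
    inverts x |-> x - shift x, hence x represents 0 if and only if its partial
    sums have finite support, that is, vanish eventually. *)
Fixpoint psum x (k : nat) : E k :=
  if k is j.+1 then t j (psum x j) + x j.+1 else x 0%N.

Lemma psum_telescope x : psum (x - shift t x) = x.
Proof.
apply/functional_extensionality_dep; elim=> [|k IH] /=; first exact: subr0.
by rewrite IH -[(x - _) k.+1]/(x k.+1 - t k (x k)) addrC subrK.
Qed.

Lemma telescope_psum x : (psum x : dprod E) - shift t (psum x) = x.
Proof.
apply/functional_extensionality_dep; case=> [|k]; first exact: subr0.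
by rewrite -[LHS]/(t k (psum x k) + x k.+1 - t k (psum x k)) addrC addKr.
Qed.

Lemma psumZ r x k : psum (r *: x) k = r *: psum x k.
Proof. by elim: k => //= k ->; rewrite scalerDr linearZZ. Qed.

(** The element u is the image of e under the canonical map from E m.  Stating
    this with psum avoids transporting along equalities of indices. *)
Definition stage u (m : nat) (e : E m) := exists z : sub_module (dsum E),
  [/\ u = quot_proj (Defs.restrict (dsum E) (Defs.telescope t)) z,
      forall k, (m < k)%N -> sub_incl (dsum E) z k = 0 &
      psum (sub_incl (dsum E) z) m = e].

Lemma stage_repr u : exists m (e : E m), stage u e.
Proof.
pose z : sub_module (dsum E) := repr u.
have [m zm] := sub_inclP z; exists m, (psum (sub_incl (dsum E) z) m), z.
by split=> // [|k /ltnW]; [rewrite quot_projK|exact: zm].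
Qed.

Lemma stage_of m (e : E m) : exists u, stage u e.
Proof.
pose x : dprod E := dfwith (fun k => 0 : E k) e.
have x0 k : k != m -> x k = 0 by move=> km; rewrite /x dfwith_out // eq_sym.
have Dx : carrier (dsum E) x.
  by exists m.+1 => k mk; apply: x0; rewrite gtn_eqF.
have [z zx] := sub_incl_onto Dx.
exists (quot_proj (Defs.restrict (dsum E) (Defs.telescope t)) z), z; rewrite zx; split=> //.
  by move=> k mk; apply: x0; rewrite gtn_eqF.
have below k : (k < m)%N -> psum x k = 0.
  elim: k => [|k IH] km /=; first by apply: x0; rewrite ltn_eqF.
  by rewrite IH ?(ltnW km) // linear0 add0r; apply: x0; rewrite ltn_eqF.
case: m e @x {x0 Dx zx} below => [|m] e x below /=; first exact: dfwith_in.
by rewrite below // linear0 add0r /x dfwith_in.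
Qed.

Lemma stageZ r u m (e : E m) : stage u e -> stage (r *: u) (r *: e).
Proof.
move=> [z [-> zm <-]]; exists (r *: z); rewrite !linearZZ psumZ; split=> // k mk.
by rewrite -[LHS]/(r *: sub_incl (dsum E) z k) zm // scaler0.
Qed.

Lemma psum_stable x m : (forall k, (m < k)%N -> x k = 0) ->
  forall d, psum x (m + d).+1 = t (m + d) (psum x (m + d)).
Proof. by move=> xm d /=; rewrite xm ?addr0 // ltnS leq_addr. Qed.

Lemma stage0 u m : stage u (0 : E m) -> u = 0.
Proof.
move=> [z [-> zm z0]]; apply/quot_proj_eq0.
set x := sub_incl (dsum E) z in zm z0 *.
exists (psum x); last exact: telescope_psum.
exists m => k /subnKC <-; elim: (k - m)%N => [|d IH]; first by rewrite addn0.
by rewrite addnS psum_stable // IH linear0.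
Qed.

Variables (p : set R).
Hypothesis prime_p : prime_ideal p.

(** When the transition maps are injective at p, so are the canonical maps to
    the limit. *)
Lemma stage_eq0 u m (e : E m) :
  (forall k (e : E k), t k e = 0 -> exists2 s, ~ p s & s *: e = 0) ->
  stage u e -> u = 0 -> exists2 s, ~ p s & s *: e = 0.
Proof.
move=> t_inj [z [-> zm <-]] /quot_proj_eq0; set x := sub_incl (dsum E) z in zm *.
move=> [y [m' ym'] yx].
have : psum x (m + m') = 0.
  by rewrite -[x]yx psum_telescope ym' // leq_addl.
clearbody x; elim: m' {y ym' yx} => [|d IH] in x zm *.
  by rewrite addn0 => x0; exists 1; rewrite ?scale1r //; exact: not_prime1.
rewrite addnS psum_stable // => /t_inj [s ps]; rewrite -psumZ => sx0.
have [|s' ps'] := IH (s *: x) _ sx0.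
  by move=> k mk; rewrite -[LHS]/(s *: x k) zm // scaler0.
by rewrite psumZ scalerA; exists (s' * s) => //; exact: not_primeM.
Qed.

Lemma limit_vanishes : (forall k, vanishes p (E k)) -> vanishes p (direct_limit t).
Proof.
move=> van u; have [m [e ue]] := stage_repr u; have [s ps se] := van m e.
by exists s => //; apply: (@stage0 _ m); rewrite -se; exact: stageZ.
Qed.

Lemma vanishes_limit :
  (forall k (e : E k), t k e = 0 -> exists2 s, ~ p s & s *: e = 0) ->
  vanishes p (direct_limit t) -> forall k, vanishes p (E k).
Proof.
move=> t_inj van k e; have [u ue] := stage_of e; have [s ps su] := van u.
have [s' ps'] := stage_eq0 t_inj (stageZ s ue) su.
by rewrite scalerA; exists (s' * s) => //; exact: not_primeM.
Qed.
End DirectLimitStages.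

(** * Powers of an ideal *)

Section IdealPowers.
Variables (R : comNzRingType) (a : ideal R) (M : lmodType R).

(** Needed as a Leibniz equality: it identifies the types M / a^1 M and
    M / aM. *)
Lemma submodule_eq (V : lmodType R) (S T : submodule V) : carrier S = carrier T -> S = T.
Proof.
case: S T => [S SP] [T TP] /= ST; case: _ / ST in TP *.
by rewrite (Prop_irrelevance SP TP).
Qed.

Lemma ideal_pow1 : ideal_pow a 1 = a.
Proof.
apply/submodule_eq/seteqP; split.
  apply: smallest_sub; first exact: carrierP.
  move=> _ [r ar [x _ <-]]; have [_ _ aZ] := carrierP a.
  by rewrite /GRing.scale /= mulrC; exact: aZ.
move=> r ar; apply: sub_gen_smallest; exists r => //; exists 1 => //.
exact: mulr1.
Qed.

(** If r M is contained in aM, then r maps a^k M into a^(k+1) M, so that r^k M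
    is contained in a^k M. *)
Lemma nilpotent_mod_pow r :
  (forall y : quot_ideal a M, r *: y = 0) ->
  forall k (y : quot_ideal (ideal_pow a k) M), r ^+ k *: y = 0.
Proof.
move=> rL k y; have [v <-] := quot_proj_onto y.
have {}rL (w : M) : carrier (ideal_smul a (full M)) (r *: w).
  by apply/quot_proj_eq0; rewrite linearZZ; exact: rL.
rewrite -linearZZ; apply/quot_proj_eq0.
elim: k {y} => [|k IH].
  apply: sub_gen_smallest; exists 1 => //; exists v => //.
rewrite exprS -scalerA; move: (r ^+ k *: v) IH.
apply: (@smallest_sub _ _ _
  (fun w => carrier (ideal_smul (ideal_pow a k.+1) (full M)) (r *: w))).
  exact: (preim_is_sub (scalar_map M r)).
move=> _ [c ac [w _ <-]]; rewrite scalerA mulrC -scalerA.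
move: (r *: w) (rL w).
apply: (@smallest_sub _ _ _
  (fun w => carrier (ideal_smul (ideal_pow a k.+1) (full M)) (c *: w))).
  exact: (preim_is_sub (scalar_map M c)).
move=> _ [d ad [v' _ <-]]; apply: sub_gen_smallest; exists (d * c).
  by apply: sub_gen_smallest; exists d => //; exists c.
by exists v' => //; rewrite mulrC scalerA.
Qed.
End IdealPowers.

(** * Associated primes outside the supports in lower degrees *)

Section AtPrime.
Variables (R : comNzRingType) (noethR : noetherian_ring R).
Variables (p : set R) (prime_p : prime_ideal p).
Variables (a : ideal R) (M : lmodType R) (fgM : finitely_generated M).
Variables (X : lmodType R) (J : injective_resolution X).

Local Notation L := (quot_ideal a M).
Local Notation Mpow k := (quot_ideal (ideal_pow a k) M).
Local Notation annL := [set r | forall y : L, r *: y = 0].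
Local Notation H := (local_cohomology a M J).

Lemma fg_quot (K : submodule M) : exists xs : seq (quot_module K), spanned xs.
Proof.
have [xs spM] := finitely_generated_spanned fgM.
by exists (map (quot_proj K) xs); exact: spanned_onto (@quot_proj_onto _ _ K) spM.
Qed.

Lemma nil_fg_pow k : nil_fg annL (Mpow k).
Proof.
split; first exact: fg_quot.
by move=> r rL y; exists k; exact: nilpotent_mod_pow.
Qed.

Lemma nil_fg_L : nil_fg annL L.
Proof. by split; [exact: fg_quot|move=> r rL y; exists 1%N; exact: rL]. Qed.

Lemma quot_ideal_pow1 : L = Mpow 1.
Proof. by rewrite ideal_pow1. Qed.

Section Degree.
Variable n : nat.
Hypothesis vL : forall i, (i < n)%N -> vanishes p (Ext J i L).

Lemma ext_vanishes_below j :
  n = j.+1 -> forall N, nil_fg annL N -> vanishes p (Ext J j N).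
Proof.
by move=> nj; apply: (vanishes_nil_lt noethR prime_p (fg_quot _) vL); rewrite nj.
Qed.

(** The kernel of M / a^(k+1) M -> M / a^k M is in the class of modules whose
    lower Ext groups vanish at p. *)
Lemma transition_inj k (u : Ext J n (Mpow k)) :
  Ext_map J (quot_pow_proj a M k) n u = 0 -> exists2 s, ~ p s & s *: u = 0.
Proof.
have [f fu] := class_repr u.
move=> /(class_eq0 (class_map (quot_pow_proj a M k) fu)) fb.
have onto_k : onto (quot_pow_proj a M k).
  move=> y; have [v <-] := quot_proj_onto y.
  by exists (quot_proj _ v); exact: quot_mapE.
have [s ps sf] :=
  ext_inj_nil noethR prime_p ext_vanishes_below onto_k (nil_fg_pow k.+1) fb.
by exists s => //; exact/(class_eq0 (classZ s fu)).
Qed.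

(** The map from stage 1 to the limit is injective at p, and p is prime, so
    annihilators equal to p are preserved. *)
Lemma Ass_ext_limit : Ass (Ext J n L) p -> Ass (H n) p.
Proof.
rewrite quot_ideal_pow1 => -[_ [u pu]]; split=> //.
have [h hu] := @stage_of _ _ (fun k => Ext_map J (quot_pow_proj a M k) n) 1%N u.
exists h; rewrite pu; apply/seteqP; split=> r /=.
  by move=> ru; apply: (@stage0 _ _ _ _ 1%N); rewrite -ru; exact: stageZ.
move=> rh; have [s ps] := stage_eq0 prime_p transition_inj (stageZ r hu) rh.
rewrite scalerA => sru; have [_ _ pM] := prime_p.
have /pM [//|] : p (s * r) by rewrite pu.
by rewrite pu.
Qed.

(** A class with annihilator p at stage k is, up to an element outside p, the
    pullback of a class g on a quotient N of M / a^k M killed by p; its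
    pullback along L -> N has annihilator p, since Ext^n(N) embeds at p both in
    Ext^n(L) and in Ext^n(M / a^k M). *)
Lemma Ass_limit_ext : Ass (H n) p -> Ass (Ext J n L) p.
Proof.
move=> [_ [h ph]]; split=> //.
have [k [u hu]] := stage_repr h; have [f fu] := class_repr u.
have in_p r : p r <-> r *: h = 0 by rewrite ph.
have fp r : p r -> exists2 s, ~ p s & carrier (coboundaries J (Mpow k) n) ((s * r) *: f).
  move=> /in_p rh; have [s ps] := stage_eq0 prime_p transition_inj (stageZ r hu) rh.
  by rewrite scalerA => /(class_eq0 (classZ (s * r) fu)); exists s.
have pf r : carrier (coboundaries J (Mpow k) n) (r *: f) -> p r.
  move=> /(class_eq0 (classZ r fu)) ru; apply/in_p.
  by apply: (@stage0 _ _ _ _ k); rewrite -ru; exact: stageZ.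
have [p_sub p1 pM] := prime_p.
have [rs [rsp spp]] := noetherian_ideal noethR (Submodule p_sub).
have [N [pi [g [s [pi_onto rsN gc ps sfg]]]]] :=
  cocycle_factor_killed noethR prime_p ext_vanishes_below (nil_fg_pow k)
    (class_cocycle fu) (fun r rrs => fp r (rsp r rrs)).
have pN r : p r -> forall y : N, r *: y = 0.
  by move=> pr y; apply: (spp (ker (line_map y))) pr => t trs; exact: rsN.
(* The element r acts nilpotently on M / a^k M, hence on f, and p is prime. *)
have ap (r : R) : carrier a r -> p r.
  move=> ar; apply: (prime_exp (m := k) prime_p); apply: pf.
  suff -> : r ^+ k *: f = 0 by have [] := carrierP (coboundaries J (Mpow k) n).
  apply/linear_funext => y; rewrite homZ -linearZZ nilpotent_mod_pow ?linear0 //.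
  move=> z; have [v <-] := quot_proj_onto z; rewrite -linearZZ.
  by apply/quot_proj_eq0; apply: sub_gen_smallest; exists r => //; exists v.
pose rho : {linear M -> N} := pi \o quot_proj (ideal_smul (ideal_pow a k) (full M)).
have [v aMv|sigma sigmaE] :=
    @factor_onto _ _ _ _ (quot_proj (ideal_smul a (full M))) rho (@quot_proj_onto _ _ _).
  have : carrier (ker rho) v.
    move/quot_proj_eq0: aMv; apply: smallest_sub; first exact: carrierP.
    move=> _ [r ar [w _ <-]].
    exact: etrans (linearZZ rho r w) (pN r (ap r ar) (rho w)).
  by [].
have sigma_onto : onto sigma.
  move=> y; have [z <-] := pi_onto y; have [v <-] := quot_proj_onto z.
  by exists (quot_proj _ v); rewrite sigmaE.
have [z gz] := cocycle_class (precomp_cocycles sigma gc).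
exists z; apply/seteqP; split=> r /=.
  move=> pr; apply/(class_eq0 (classZ r gz)).
  suff -> : r *: precomp sigma g = 0 by have [] := carrierP (coboundaries J L n).
  by apply/linear_funext => y; rewrite homZ /= -linearZZ pN // linear0.
move=> /(class_eq0 (classZ r gz)); rewrite -precompZ => rg.
have [t pt trg] :=
  ext_inj_nil noethR prime_p ext_vanishes_below sigma_onto nil_fg_L rg.
have [_ BD BZ] := carrierP (coboundaries J (Mpow k) n).
(* If r annihilated z, then t r s f would bound for some t and s outside p. *)
have := BD _ _ (BZ (t * r) _ sfg) (precomp_coboundaries pi trg).
rewrite scalerBr !precompZ !scalerA subrK => /pf /pM [/pM [//|//]|//].
Qed.
End Degree.

(** From right to left, by induction on the degree: once the lower Ext groups
    vanish at p, Ext^i(L) embeds in H^i at p. *)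
Lemma vanishes_ext_limit n :
  (forall i, (i < n)%N -> vanishes p (Ext J i L)) <->
  (forall i, (i < n)%N -> vanishes p (H i)).
Proof.
split=> [vL i lt_in|vH].
  apply: limit_vanishes => k.
  exact: (vanishes_nil_lt noethR prime_p (fg_quot _) vL lt_in (nil_fg_pow k)).
elim/ltn_ind => i IH lt_in.
have vL j : (j < i)%N -> vanishes p (Ext J j L).
  by move=> lt_ji; apply: IH => //; exact: ltn_trans lt_in.
rewrite quot_ideal_pow1.
exact: (@vanishes_limit _ _ (fun k => Ext_map J (quot_pow_proj a M k) i) _ prime_p
  (transition_inj vL) (vH _ lt_in) 1%N).
Qed.

End AtPrime.

Unset Implicit Arguments.

Theorem corollary3p9 (R : comNzRingType) (noethR : noetherian_ring R)
    (a : ideal R) (M : lmodType R) (fgM : finitely_generated M)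
    (X : lmodType R) (J : injective_resolution X) (n : nat) :
  let H (i : nat) := local_cohomology a M J i in
  let E (i : nat) := Ext J i (quot_ideal a M) in
  let P := \bigcup_(i < n) Supp (H i) in
  [/\ P = \bigcup_(i < n) Supp (E i),
      Ass (H n) `|` P = Ass (E n) `|` P,
      Ass (H n) `<=` Ass (E n) `|` P,
      Ass (E n) `<=` Ass (H n) `|` P &
      (forall i : nat, (i < n)%N -> finite_set (Supp (H i))) ->
      (finite_set (Ass (H n)) <-> finite_set (Ass (E n)))].
Proof.
move=> H E P.
have notP (F : nat -> lmodType R) p : prime_ideal p ->
    ~ (\bigcup_(i < n) Supp (F i)) p <-> forall i, (i < n)%N -> vanishes p (F i).
  move=> pp; split=> [nP i lt_in|van [i lt_in /(Supp_vanishes pp)]]; last first.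
    by apply; exact: van.
  by apply: contrapT => nv; apply: nP; exists i => //; exact/(Supp_vanishes pp).
have PE : P = \bigcup_(i < n) Supp (E i).
  have eqP p : prime_ideal p -> ~ P p <-> ~ (\bigcup_(i < n) Supp (E i)) p.
    move=> pp; rewrite !notP //; apply: iff_sym.
    exact: (vanishes_ext_limit noethR pp a fgM J n).
  by apply/seteqP; split=> p [i lt_in Fp]; have pp := Fp.1; apply: contrapT;
    move/(eqP p pp); apply; exists i.
have vE p : prime_ideal p -> ~ P p -> forall i, (i < n)%N -> vanishes p (E i).
  by move=> pp; rewrite PE => /notP; apply.
have HE : Ass (H n) `<=` Ass (E n) `|` P.
  move=> p Hp; have [|nP] := pselect (P p); [by right|left].
  by have pp := Hp.1; apply: (Ass_limit_ext noethR pp fgM (vE p pp nP)) Hp.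
have EH : Ass (E n) `<=` Ass (H n) `|` P.
  move=> p Ep; have [|nP] := pselect (P p); [by right|left].
  by have pp := Ep.1; apply: (Ass_ext_limit noethR pp fgM (vE p pp nP)) Ep.
split=> // [|finP].
  by apply/seteqP; split=> p [Fp|Pp]; [exact: HE|right|exact: EH|right].
have {}finP : finite_set P by apply: bigcup_finite => //; exact: finite_II.
by split=> fin; [apply: sub_finite_set EH _|apply: sub_finite_set HE _];
  rewrite finite_setU.
Qed.
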